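(* Let $p$ be a prime and let $x\in[0,1]$. (1) There exists a function $\psi:\mathbb{N}\to\mathbb{R}_{\ge 0}$ such that $\mu_p(\mathcal{C}^p(\psi)) = x$ if and only if $x$ is of the form $$x = \sum_{k=0}^{\infty} x_k (p-1) p^{-k-1},\qquad x_k\in\{0,1\}\ \text{ for all } k\in\mathbb{N}_0.$$ (2) There exists a function $\psi:\mathbb{N}\to\mathbb{R}_{\ge 0}$ such that $\mu_p(\mathcal{B}^p(\psi)) = x$ if and only if $x=1$ or $x$ is of the form $$x = \sum_{k=1}^{\infty} x_k (p-1) p^{-k-1},\qquad x_k\in\{0,1\}\ \text{ for all } k\in\mathbb{N}.$$
   Context: $\mathbb{N}=\{1,2,\dots\}$, $\mathbb{N}_0=\mathbb{N}\cup\{0\}$. $\mu_p$ is the Haar measure on $\mathbb{Q}_p$ normalized by $\mu_p(\mathbb{Z}_p)=1$. $B_{\mathbb{Q}_p}(x,r)=\{y\in\mathbb{Q}_p:|y-x|_p\le r\}$ is the closed ball (equal to $\{x\}$ when $r=0$). For $\psi:\mathbb{N}\to\mathbb{R}_{\ge 0}$, the set $\mathcal{B}^p(\psi)$ consists of all $\alpha\in\mathbb{Z}_p$ for which $$\left|\alpha-\frac{a}{n}\right|_p\le \frac{\psi(\max\{|a|,|n|\})}{\max\{|a|,|n|\}}$$ holds for infinitely many rational numbers $a/n$, written as reduced fractions ($a\in\mathbb{Z}$, $n\in\mathbb{N}$, $\gcd(a,n)=1$); here $|a|,|n|$ are ordinary absolute values. For $n\in\mathbb{N}$ put $$\mathcal{C}^p_n(\psi)=\bigcup_{\substack{a\in\mathbb{Z},\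 |a|<n\\ \gcd(a,pn)=1}} B_{\mathbb{Q}_p}\left(\frac{n}{a},\frac{\psi(n)}{n}\right)\cap\mathbb{Z}_p$$ (an empty union for $n=1$), and $\mathcal{C}^p(\psi)=\limsup_{n\to\infty}\mathcal{C}^p_n(\psi)=\bigcap_{N\ge1}\bigcup_{n\ge N}\mathcal{C}^p_n(\psi)$. (For $n>1$ the same set is obtained if the condition $\gcd(a,pn)=1$ is replaced by $\gcd(a,n)=1$.) *)

(* Defs.v *)
From HB Require Import structures.
From mathcomp Require Import all_boot all_order all_algebra.
From mathcomp Require Import generic_quotient ring_quotient.
From mathcomp Require Import all_classical all_reals all_analysis.

Set Implicit Arguments.
Unset Strict Implicit.
Unset Printing Implicit Defensive.

Import Order.TTheory GRing.Theory Num.Theory.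
Import numFieldNormedType.Exports.

Local Open Scope classical_set_scope.
Local Open Scope ring_scope.
Local Open Scope quotient_scope.

(* For p not prime, logn p is constantly 0 and this is the trivial absolute   *)
(* value, so the construction below needs no primality assumption.            *)
Definition padic_abs (p : nat) (q : rat) : rat :=
  if q == 0 then 0
  else (p ^ logn p `|denq q|)%:R / (p ^ logn p `|numq q|)%:R.

Section PadicAbs.
Variable p : nat.

Let pl n : (0 : rat) < (p ^ logn p n)%:R.
Proof.
rewrite ltr0n expn_gt0; case: p => [|//].
by rewrite lognE.
Qed.

Let pl0 n : (p ^ logn p n)%:R != 0 :> rat.
Proof. by rewrite gt_eqF. Qed.

Lemma padic_abs0 : padic_abs p 0 = 0.
Proof. by rewrite /padic_abs eqxx. Qed.

Lemma padic_abs_gt0 q : q != 0 -> 0 < padic_abs p q.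
Proof. by move=> /negPf q0; rewrite /padic_abs q0 divr_gt0. Qed.

Lemma padic_abs_ge0 q : 0 <= padic_abs p q.
Proof.
by have [->|/padic_abs_gt0/ltW//] := eqVneq q 0; rewrite padic_abs0.
Qed.

Lemma padic_abs_eq0 q : (padic_abs p q == 0) = (q == 0).
Proof.
have [->|/padic_abs_gt0] := eqVneq q 0; first by rewrite padic_abs0 eqxx.
by move/gt_eqF.
Qed.

Lemma padic_abs_frac (a b : int) : a != 0 -> b != 0 ->
  padic_abs p (a%:Q / b%:Q) = (p ^ logn p `|b|)%:R / (p ^ logn p `|a|)%:R.
Proof.
move=> a0 b0; set q := a%:Q / b%:Q.
have q0 : q != 0 by rewrite mulf_neq0 ?invr_eq0 ?intr_eq0.
rewrite /padic_abs (negPf q0); apply/eqP.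
rewrite eqr_div ?pl0// -!natrM eqr_nat -!expnD.
have nq0 : numq q != 0 by rewrite numq_eq0.
have E : (numq q * b = a * denq q)%R.
  apply/eqP; rewrite -(eqr_int rat) !rmorphM/=; apply/eqP.
  have: (numq q)%:~R / (denq q)%:~R = a%:~R / b%:~R :> rat by rewrite divq_num_den.
  move/eqP; rewrite eqr_div ?intr_eq0 ?denq_eq0//.
  by move/eqP.
have : (`|numq q| * `|b| = `|a| * `|denq q|)%N by rewrite -!abszM E.
move/(congr1 (logn p)); rewrite !lognM ?absz_gt0 ?denq_eq0// => H.
by rewrite addnC -H addnC.
Qed.

Lemma padic_absM : {morph padic_abs p : x y / x * y}.
Proof.
move=> x y.
have [->|x0] := eqVneq x 0; first by rewrite mul0r padic_abs0 mul0r.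
have [->|y0] := eqVneq y 0; first by rewrite mulr0 padic_abs0 mulr0.
have nx : numq x != 0 by rewrite numq_eq0.
have ny : numq y != 0 by rewrite numq_eq0.
rewrite -[x in LHS]divq_num_den -[y in LHS]divq_num_den mulf_div -!intrM.
rewrite padic_abs_frac ?mulf_neq0 ?denq_eq0//.
rewrite /padic_abs (negPf x0) (negPf y0) mulf_div -!natrM -!expnD.
by rewrite !abszM !lognM ?absz_gt0 ?denq_eq0.
Qed.

Lemma padic_abs1 : padic_abs p 1 = 1.
Proof. by rewrite /padic_abs oner_eq0 /= logn1 divr1. Qed.

Lemma padic_absN x : padic_abs p (- x) = padic_abs p x.
Proof. by rewrite /padic_abs oppr_eq0 numqN denqN abszN. Qed.

Lemma padic_absB x y : padic_abs p (x - y) = padic_abs p (y - x).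
Proof. by rewrite -padic_absN opprB. Qed.

Lemma padic_absV x : padic_abs p x^-1 = (padic_abs p x)^-1.
Proof.
have [->|x0] := eqVneq x 0; first by rewrite invr0 !padic_abs0 ?invr0.
apply: (mulIf (x := padic_abs p x)); first by rewrite padic_abs_eq0.
by rewrite -padic_absM !mulVf ?padic_abs1// padic_abs_eq0.
Qed.

Let padic_absz (a : int) : a != 0 ->
  padic_abs p a%:~R = (p ^ logn p `|a|)%:R^-1.
Proof.
by move=> a0; rewrite -[a%:~R]divr1 (padic_abs_frac (b := 1))// logn1 expn0 mul1r.
Qed.

Let padic_abs_lez (a b : int) :
  padic_abs p (a + b)%:~R <= Num.max (padic_abs p a%:~R) (padic_abs p b%:~R).
Proof.
have [->|a0] := eqVneq a 0; first by rewrite add0r le_max lexx orbT.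
have [->|b0] := eqVneq b 0; first by rewrite addr0 le_max lexx.
have [->|ab0] := eqVneq (a + b) 0.
  by rewrite padic_abs0 le_max padic_abs_ge0.
rewrite !padic_absz//; case: (boolP (prime p)) => [pp|np]; last first.
  have l0 n : logn p n = 0%N by rewrite lognE (negPf np).
  by rewrite !l0 maxxx.
rewrite le_max !lef_pV2 ?posrE ?pl// !ler_nat.
rewrite !leq_exp2l ?prime_gt1//.
wlog: a b a0 b0 ab0 / (logn p `|a| <= logn p `|b|)%N => [H|ab].
  have [|/ltnW] := leqP (logn p `|a|) (logn p `|b|); first exact: H.
  by move=> ba; rewrite orbC addrC H // addrC.
apply/orP; left.
rewrite -pfactor_dvdn ?absz_gt0//.
have da : (p ^ logn p `|a| %| `|a|)%N by exact: pfactor_dvdnn.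
have db : (p ^ logn p `|a| %| `|b|)%N.
  by rewrite pfactor_dvdn ?absz_gt0.
have : ((p ^ logn p `|a|)%N %| a + b)%Z.
  by apply: rpredD; rewrite dvdzE.
by rewrite dvdzE.
Qed.

Lemma padic_abs_max x y :
  padic_abs p (x + y) <= Num.max (padic_abs p x) (padic_abs p y).
Proof.
set d := (denq x * denq y)%:~R : rat.
have d0 : 0 < padic_abs p d.
  by rewrite padic_abs_gt0// intr_eq0 mulf_neq0 ?denq_eq0.
rewrite -(ler_pM2r d0) maxr_pMl ?(ltW d0)// -!padic_absM mulrDl.
have -> : x * d = (numq x * denq y)%:~R.
  by rewrite /d !rmorphM/= mulrA; congr (_ * _); rewrite numqE.
have -> : y * d = (numq y * denq x)%:~R.
  by rewrite /d [denq x * _]mulrC !rmorphM/= mulrA; congr (_ * _); rewrite numqE.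
by rewrite -intrD padic_abs_lez.
Qed.

Lemma padic_abs_add x y :
  padic_abs p (x + y) <= padic_abs p x + padic_abs p y.
Proof.
apply: (le_trans (padic_abs_max _ _)).
by rewrite ge_max lerDl lerDr !padic_abs_ge0.
Qed.

Lemma padic_abs_dominant x y :
  padic_abs p (x - y) < padic_abs p x -> padic_abs p y = padic_abs p x.
Proof.
move=> h; apply/eqP; rewrite eq_le; apply/andP; split.
  have := padic_abs_max (y - x) x; rewrite subrK => /le_trans; apply.
  by rewrite ge_max lexx andbT padic_absB ltW.
have := padic_abs_max (x - y) y; rewrite subrK le_max => /orP[|//].
by rewrite leNgt h.
Qed.

End PadicAbs.

Definition padic_cauchy (p : nat) : pred (nat -> rat) := fun u =>
  `[< forall e : rat, 0 < e -> exists N : nat, forall m n : nat,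
        (N <= m)%N -> (N <= n)%N -> padic_abs p (u m - u n) < e >].

Definition padic_null (p : nat) : pred (nat -> rat) := fun u =>
  `[< forall e : rat, 0 < e -> exists N : nat, forall n : nat,
        (N <= n)%N -> padic_abs p (u n) < e >].

Section CauchyRing.
Variable p : nat.

Lemma padic_cauchyP (u : nat -> rat) : reflect
  (forall e : rat, 0 < e -> exists N : nat, forall m n : nat,
        (N <= m)%N -> (N <= n)%N -> padic_abs p (u m - u n) < e)
  (u \in padic_cauchy p).
Proof. exact: asboolP. Qed.

Lemma padic_nullP (u : nat -> rat) : reflect
  (forall e : rat, 0 < e -> exists N : nat, forall n : nat,
        (N <= n)%N -> padic_abs p (u n) < e)
  (u \in padic_null p).
Proof. exact: asboolP. Qed.

Lemma padic_cauchy_cst (q : rat) : (fun=> q) \in padic_cauchy p.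
Proof.
by apply/padic_cauchyP => e e0; exists 0%N => m n _ _; rewrite subrr padic_abs0.
Qed.

Lemma padic_cauchy_bounded (u : nat -> rat) : u \in padic_cauchy p ->
  exists M : rat, exists N : nat, 0 < M /\
    forall n : nat, (N <= n)%N -> padic_abs p (u n) < M.
Proof.
move=> /padic_cauchyP/(_ 1 ltr01)[N hN].
exists (1 + padic_abs p (u N)), N; split.
  by rewrite ltr_pwDl// padic_abs_ge0.
move=> n Nn; have := padic_abs_add p (u n - u N) (u N).
rewrite subrK => /le_lt_trans; apply.
by rewrite ltrD2r hN.
Qed.

Lemma padic_cauchy_subring : subring_closed (padic_cauchy p).
Proof.
split; first exact: padic_cauchy_cst.
  move=> u v /padic_cauchyP uc /padic_cauchyP vc; apply/padic_cauchyP => e e0.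
  have [N hN] := uc e e0; have [M hM] := vc e e0.
  exists (maxn N M) => m n; rewrite !geq_max => /andP[Nm Mm] /andP[Nn Mn].
  rewrite /= -[(u - v) m]/(u m - v m) -[(u - v) n]/(u n - v n).
  have -> : u m - v m - (u n - v n) = (u m - u n) + (v n - v m).
    by rewrite opprB [v n - u n]addrC addrACA [- v m + _]addrC.
  apply: (le_lt_trans (padic_abs_max _ _ _)).
  by rewrite gt_max hN//= hM.
move=> u v uc vc; apply/padic_cauchyP => e e0.
have [B [Nb [B0 hB]]] := padic_cauchy_bounded uc.
have [C [Nc [C0 hC]]] := padic_cauchy_bounded vc.
move/padic_cauchyP: uc => uc; move/padic_cauchyP: vc => vc.
have [N hN] := uc (e / C) (divr_gt0 e0 C0).
have [M hM] := vc (e / B) (divr_gt0 e0 B0).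
exists (maxn (maxn N M) (maxn Nb Nc)) => m n.
rewrite !geq_max => /andP[/andP[Nm Mm] /andP[Nbm Ncm]].
move=> /andP[/andP[Nn Mn] /andP[Nbn Ncn]].
rewrite -[(u * v) m]/(u m * v m) -[(u * v) n]/(u n * v n).
have -> : u m * v m - u n * v n = (u m - u n) * v m + u n * (v m - v n).
  by rewrite mulrBl mulrBr addrA subrK.
apply: (le_lt_trans (padic_abs_max _ _ _)).
rewrite gt_max !padic_absM; apply/andP; split.
  rewrite -[ltRHS](divfK (lt0r_neq0 C0)).
  by apply: ltr_pM; rewrite ?padic_abs_ge0 ?hN ?hC.
rewrite -[ltRHS](divfK (lt0r_neq0 B0)) mulrC.
by apply: ltr_pM; rewrite ?padic_abs_ge0 ?hM ?hB.
Qed.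

HB.instance Definition _ :=
  GRing.isSubringClosed.Build (nat -> rat) (padic_cauchy p) padic_cauchy_subring.

Record cauchy_seq := CauchySeq {
  cauchy_val :> nat -> rat;
  cauchy_valP : cauchy_val \in padic_cauchy p }.

HB.instance Definition _ := [isSub for cauchy_val].
HB.instance Definition _ := [Choice of cauchy_seq by <:].
HB.instance Definition _ := [SubChoice_isSubComNzRing of cauchy_seq by <:].

Definition null_seq : pred cauchy_seq := fun u => (u : nat -> rat) \in padic_null p.

Lemma null_seq_zmod : zmod_closed null_seq.
Proof.
split.
  apply/padic_nullP => e e0; exists 0%N => n _.
  by rewrite -[X in padic_abs p X]/0 padic_abs0.
move=> u v /padic_nullP uc /padic_nullP vc; apply/padic_nullP => e e0.
have [N hN] := uc e e0; have [M hM] := vc e e0.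
exists (maxn N M) => n; rewrite geq_max => /andP[Nn Mn].
rewrite -[X in padic_abs p X]/(u n - v n).
apply: (le_lt_trans (padic_abs_max _ _ _)).
by rewrite gt_max padic_absN hN//= hM.
Qed.

Lemma null_seq_ideal :
  (1 : cauchy_seq) \notin null_seq /\
  forall a : cauchy_seq, {in null_seq, forall u, a * u \in null_seq}.
Proof.
split.
  apply/negP => /padic_nullP/(_ 1 ltr01)[N /(_ N (leqnn N))].
  by rewrite -[X in padic_abs p X]/1 padic_abs1 ltxx.
move=> u v /padic_nullP vc; apply/padic_nullP => e e0.
have [B [Nb [B0 hB]]] := padic_cauchy_bounded (cauchy_valP u).
have [N hN] := vc (e / B) (divr_gt0 e0 B0).
exists (maxn N Nb) => n; rewrite geq_max => /andP[Nn Nbn].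
rewrite -[X in padic_abs p X]/(u n * v n) padic_absM.
rewrite -[ltRHS](divfK (lt0r_neq0 B0)) mulrC.
by apply: ltr_pM; rewrite ?padic_abs_ge0 ?hN ?hB.
Qed.

HB.instance Definition _ := GRing.isZmodClosed.Build cauchy_seq null_seq null_seq_zmod.
HB.instance Definition _ := isProperIdeal.Build cauchy_seq null_seq null_seq_ideal.

Lemma cauchy_seq_abs_cst (u : cauchy_seq) : u \notin null_seq ->
  exists N : nat, forall n : nat, (N <= n)%N ->
    padic_abs p (u n) = padic_abs p (u N) /\ u n != 0.
Proof.
move=> /padic_nullP/existsNP[e /not_implyP[e0 /forallNP h]].
have /padic_cauchyP/(_ e e0)[N hN] := cauchy_valP u.
have /existsNP[k /not_implyP[Nk /negP]] := h N; rewrite -leNgt => ek.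
have H n : (N <= n)%N -> padic_abs p (u n) = padic_abs p (u k).
  move=> Nn; apply: padic_abs_dominant.
  by apply: lt_le_trans ek; exact: hN.
exists N => n Nn; rewrite !H//; split=> //.
by rewrite -(padic_abs_eq0 p) H// gt_eqF// (lt_le_trans e0).
Qed.

Lemma cauchy_seq_inv (u : cauchy_seq) : u \notin null_seq ->
  exists v : cauchy_seq, v * u - 1 \in null_seq.
Proof.
move=> /cauchy_seq_abs_cst[N hN].
have uN0 : 0 < padic_abs p (u N) by rewrite padic_abs_gt0; have [] := hN N.
have vc : (fun n => (u n)^-1) \in padic_cauchy p.
  apply/padic_cauchyP => e e0.
  have e1 : 0 < e * padic_abs p (u N) ^+ 2 by rewrite mulr_gt0// exprn_gt0.
  have /padic_cauchyP/(_ _ e1)[M hM] := cauchy_valP u.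
  exists (maxn N M) => m n; rewrite !geq_max => /andP[Nm Mm] /andP[Nn Mn].
  have [um um0] := hN m Nm; have [un un0] := hN n Nn.
  have -> : (u m)^-1 - (u n)^-1 = (u n - u m) / (u m * u n).
    by rewrite mulrBl invfM mulrCA mulfV// mulr1 mulrA mulfV// mul1r.
  rewrite !padic_absM padic_absV padic_absM um un -expr2.
  by rewrite ltr_pdivrMr ?exprn_gt0// hM.
exists (CauchySeq vc); apply/padic_nullP => e e0; exists N => n Nn.
have [_ un0] := hN n Nn.
by rewrite -[X in padic_abs p X]/((u n)^-1 * u n - 1) mulVf// subrr.
Qed.

End CauchyRing.

Definition null_ideal (p : nat) : idealr (cauchy_seq p) := @null_seq p.

(* The field of p-adic numbers: Cauchy sequences of rationals for the p-adic  *)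
(* absolute value, modulo the maximal ideal of null sequences.                *)
Definition Qp (p : nat) : Type := {ideal_quot (null_ideal p)}.

Section Qp.
Variable p : nat.

HB.instance Definition _ := GRing.ComNzRing.on (Qp p).

Definition Qp_lim (u : cauchy_seq p) : Qp p :=
  \pi_({ideal_quot (null_ideal p)}) u.

Definition Qp_seq (x : Qp p) : cauchy_seq p :=
  @repr (cauchy_seq p) ({ideal_quot (null_ideal p)}) x.

Lemma Qp_seqK : cancel Qp_seq Qp_lim.
Proof. exact: reprK. Qed.

Lemma Qp_limE (u v : cauchy_seq p) :
  (Qp_lim u == Qp_lim v) = (u - v \in @null_seq p).
Proof. by rewrite Quotient.idealrBE. Qed.

Lemma Qp_limD : {morph Qp_lim : u v / u + v >-> u + v}.
Proof. exact: (rmorphD (\pi_({ideal_quot (null_ideal p)}))). Qed.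

Lemma Qp_limN : {morph Qp_lim : u / - u >-> - u}.
Proof. exact: (rmorphN (\pi_({ideal_quot (null_ideal p)}))). Qed.

Lemma Qp_limM : {morph Qp_lim : u v / u * v >-> u * v}.
Proof. exact: (rmorphM (\pi_({ideal_quot (null_ideal p)}))). Qed.

Lemma Qp_lim1 : Qp_lim 1 = 1.
Proof. exact: (rmorph1 (\pi_({ideal_quot (null_ideal p)}))). Qed.

Lemma Qp_lim0 : Qp_lim 0 = 0.
Proof. exact: (rmorph0 (\pi_({ideal_quot (null_ideal p)}))). Qed.

Lemma Qp_invP (x : Qp p) : exists y, (x != 0 -> y * x = 1) /\ (x = 0 -> y = 0).
Proof.
have [->|x0] := eqVneq x 0; first by exists 0.
have : Qp_seq x \notin @null_seq p.
  apply: contra x0; rewrite -{2}[x]Qp_seqK -Qp_lim0 Qp_limE.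
  by rewrite subr0.
move=> /cauchy_seq_inv[v hv]; exists (Qp_lim v); split=> // [_|/eqP]; last first.
  by rewrite (negPf x0).
apply/eqP; rewrite -{1}[x]Qp_seqK -Qp_limM -Qp_lim1 Qp_limE //.
Qed.

Definition Qp_inv (x : Qp p) : Qp p := projT1 (cid (Qp_invP x)).

Lemma Qp_mulVf (x : Qp p) : x != 0 -> Qp_inv x * x = 1.
Proof. by rewrite /Qp_inv; case: cid => y []. Qed.

Lemma Qp_inv0 : Qp_inv 0 = 0.
Proof. by rewrite /Qp_inv; case: cid => y /= [_ ->]. Qed.

HB.instance Definition _ := GRing.ComNzRing_isField.Build (Qp p) Qp_mulVf Qp_inv0.
HB.instance Definition _ := isPointed.Build (Qp p) 0.

Lemma padic_abs_dist (a b : rat) :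
  `|padic_abs p a - padic_abs p b| <= padic_abs p (a - b).
Proof.
have H c d : padic_abs p c - padic_abs p d <= padic_abs p (c - d).
  by rewrite lerBlDr -{1}[c](subrK d) padic_abs_add.
by rewrite ler_norml H andbT lerNl opprB padic_absB H.
Qed.

Let cvgQ_unique (f : nat -> rat^o) (a b : rat^o) :
  f @ \oo --> a -> f @ \oo --> b -> a = b.
Proof.
by move=> fa fb; rewrite -(cvg_lim (@norm_hausdorff _ _) fa) (cvg_lim _ fb).
Qed.

Lemma null_seq_abs_cvg (u : cauchy_seq p) : u \in @null_seq p ->
  (fun n => padic_abs p (u n) : rat^o) @ \oo --> (0 : rat^o).
Proof.
move=> /padic_nullP h; apply/cvgrPdist_lt => e e0.
have [N hN] := h e e0; exists N => // n /= Nn.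
by rewrite sub0r normrN ger0_norm ?padic_abs_ge0// hN.
Qed.

(* The p-adic absolute value on the completion: |lim u_n| = lim |u_n|.        *)
Definition Qp_abs (x : Qp p) : rat :=
  lim ((fun n => padic_abs p (Qp_seq x n) : rat^o) @ \oo).

Lemma Qp_lim_abs_cvg (u : cauchy_seq p) :
  (fun n => padic_abs p (u n) : rat^o) @ \oo --> (Qp_abs (Qp_lim u) : rat^o).
Proof.
have [l lP] : exists l : rat^o,
    (fun n => padic_abs p (u n) : rat^o) @ \oo --> l.
  have [/null_seq_abs_cvg|/cauchy_seq_abs_cst[N hN]] := boolP (u \in @null_seq p).
    by exists 0.
  exists (padic_abs p (u N)); apply: cvg_near_cst; exists N => // n /= Nn.
  by have [] := hN n Nn.
set v := Qp_seq (Qp_lim u).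
have uv : v - u \in @null_seq p by rewrite -Qp_limE Qp_seqK eqxx.
suff vl : (fun n => padic_abs p (v n) : rat^o) @ \oo --> l.
  by rewrite /Qp_abs -/v (cvg_lim _ vl).
apply/cvgrPdist_lt => e e0.
have e20 : 0 < e / 2 by rewrite divr_gt0.
move/cvgrPdist_lt: lP => /(_ _ e20)[N _ hN].
move/padic_nullP: uv => /(_ _ e20)[M hM].
exists (maxn N M) => // n /=; rewrite geq_max => /andP[Nn Mn].
rewrite -[l](subrK (padic_abs p (u n))) -addrA.
apply: (le_lt_trans (ler_normD _ _)); rewrite [ltRHS](splitr e) ltrD//.
  exact: hN.
apply: le_lt_trans (padic_abs_dist _ _) _.
by rewrite padic_absB; exact: hM.
Qed.

Lemma Qp_lim_eq0 (u : cauchy_seq p) : (Qp_lim u == 0) = (u \in @null_seq p).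
Proof. by rewrite -Qp_lim0 Qp_limE subr0. Qed.

Lemma Qp_abs0 : Qp_abs 0 = 0.
Proof.
rewrite -Qp_lim0; apply: (cvgQ_unique (@Qp_lim_abs_cvg 0)).
by apply: null_seq_abs_cvg; exact: rpred0.
Qed.

Lemma Qp_lim_abs_eventually (u : cauchy_seq p) : Qp_lim u != 0 ->
  exists N : nat, forall n : nat, (N <= n)%N ->
    padic_abs p (u n) = Qp_abs (Qp_lim u) /\ u n != 0.
Proof.
rewrite Qp_lim_eq0 => /cauchy_seq_abs_cst[N hN]; exists N => n Nn.
have [-> un0] := hN n Nn; split=> //.
apply/esym/(cvgQ_unique (@Qp_lim_abs_cvg u)).
by apply: cvg_near_cst; exists N => // m /= /hN[].
Qed.

Lemma Qp_abs_gt0 (x : Qp p) : x != 0 -> 0 < Qp_abs x.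
Proof.
rewrite -[x]Qp_seqK => /Qp_lim_abs_eventually[N /(_ N (leqnn N))[<- u0]].
exact: padic_abs_gt0.
Qed.

Lemma Qp_abs_ge0 (x : Qp p) : 0 <= Qp_abs x.
Proof.
by have [->|/Qp_abs_gt0/ltW//] := eqVneq x 0; rewrite Qp_abs0.
Qed.

Lemma Qp_abs_eq0 (x : Qp p) : (Qp_abs x == 0) = (x == 0).
Proof.
have [->|/Qp_abs_gt0] := eqVneq x 0; first by rewrite Qp_abs0 eqxx.
by move/gt_eqF.
Qed.

Lemma Qp_absM : {morph Qp_abs : x y / x * y}.
Proof.
move=> x y.
have [->|x0] := eqVneq x 0; first by rewrite mul0r Qp_abs0 mul0r.
have [->|y0] := eqVneq y 0; first by rewrite mulr0 Qp_abs0 mulr0.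
have := mulf_neq0 x0 y0; move: x0 y0.
rewrite -[x]Qp_seqK -[y]Qp_seqK -Qp_limM.
move=> /Qp_lim_abs_eventually[N hN] /Qp_lim_abs_eventually[M hM].
move=> /Qp_lim_abs_eventually[K hK].
pose n := maxn K (maxn N M).
have [<- _] := hK n (leq_maxl _ _).
have [<- _] := hN n (leq_trans (leq_maxl _ _) (leq_maxr _ _)).
have [<- _] := hM n (leq_trans (leq_maxr _ _) (leq_maxr _ _)).
exact: padic_absM.
Qed.

Lemma Qp_abs_max (x y : Qp p) :
  Qp_abs (x + y) <= Num.max (Qp_abs x) (Qp_abs y).
Proof.
have [->|x0] := eqVneq x 0; first by rewrite add0r le_max lexx orbT.
have [->|y0] := eqVneq y 0; first by rewrite addr0 le_max lexx.
have [->|] := eqVneq (x + y) 0; first by rewrite Qp_abs0 le_max Qp_abs_ge0.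
move: x0 y0; rewrite -[x]Qp_seqK -[y]Qp_seqK -Qp_limD.
move=> /Qp_lim_abs_eventually[N hN] /Qp_lim_abs_eventually[M hM].
move=> /Qp_lim_abs_eventually[K hK].
pose n := maxn K (maxn N M).
have [<- _] := hK n (leq_maxl _ _).
have [<- _] := hN n (leq_trans (leq_maxl _ _) (leq_maxr _ _)).
have [<- _] := hM n (leq_trans (leq_maxr _ _) (leq_maxr _ _)).
exact: padic_abs_max.
Qed.

Lemma Qp_abs1 : Qp_abs 1 = 1.
Proof.
have := Qp_absM 1 1; rewrite mulr1 => /eqP; rewrite eq_sym -subr_eq0.
rewrite -[X in _ - X]mulr1 -mulrBr mulf_eq0 Qp_abs_eq0 oner_eq0/= subr_eq0.
by move/eqP.
Qed.

Lemma Qp_absN (x : Qp p) : Qp_abs (- x) = Qp_abs x.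
Proof.
have [->|x0] := eqVneq x 0; first by rewrite oppr0.
have := x0; rewrite -oppr_eq0; move: x0; rewrite -[x]Qp_seqK -Qp_limN.
move=> /Qp_lim_abs_eventually[N hN] /Qp_lim_abs_eventually[M hM].
have [<- _] := hN (maxn N M) (leq_maxl _ _).
have [<- _] := hM (maxn N M) (leq_maxr _ _).
exact: padic_absN.
Qed.

Lemma Qp_absV (x : Qp p) : Qp_abs x^-1 = (Qp_abs x)^-1.
Proof.
have [->|x0] := eqVneq x 0; first by rewrite invr0 Qp_abs0 invr0.
apply: (mulIf (x := Qp_abs x)); first by rewrite Qp_abs_eq0.
by rewrite -Qp_absM !mulVf ?Qp_abs1// Qp_abs_eq0.
Qed.

Lemma Qp_abs_nat (n : nat) : Qp_abs n%:R = padic_abs p n%:R.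
Proof.
have -> : n%:R = Qp_lim n%:R :> Qp p.
  by elim: n => [|n IHn]; rewrite ?Qp_lim0// !mulrS Qp_limD Qp_lim1 IHn.
have un k : (n%:R : cauchy_seq p) k = n%:R.
  elim: n => // n IHn.
  by rewrite [in RHS]mulrS -IHn mulrS.
apply: (cvgQ_unique (@Qp_lim_abs_cvg n%:R)).
by under eq_fun do rewrite un; exact: cvg_cst.
Qed.

Lemma Qp_abs_int (n : int) : Qp_abs n%:~R = padic_abs p n%:~R.
Proof.
by case: n => n; rewrite ?NegzE ?mulrNz ?Qp_absN ?padic_absN -pmulrn Qp_abs_nat.
Qed.

Lemma Qp_abs_rat (q : rat) : Qp_abs (ratr q) = padic_abs p q.
Proof.
rewrite /ratr Qp_absM Qp_absV !Qp_abs_int -padic_absV -padic_absM.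
by rewrite divq_num_den.
Qed.

Lemma Qp_distxx (x : Qp p) : Qp_abs (x - x) = 0.
Proof. by rewrite subrr Qp_abs0. Qed.

Lemma Qp_dist_eq (x y : Qp p) : Qp_abs (x - y) = 0 -> x = y.
Proof. by move/eqP; rewrite Qp_abs_eq0 subr_eq0 => /eqP. Qed.

Lemma Qp_dist_sym (x y : Qp p) : Qp_abs (x - y) = Qp_abs (y - x).
Proof. by rewrite -Qp_absN opprB. Qed.

Lemma Qp_dist_triangle (y x z : Qp p) :
  Qp_abs (x - z) <= Qp_abs (x - y) + Qp_abs (y - z).
Proof.
rewrite -[x in x - z](subrK y) -addrA.
apply: (le_trans (Qp_abs_max _ _)).
by rewrite ge_max lerDl lerDr !Qp_abs_ge0.
Qed.

HB.instance Definition _ := @isMetric.Build rat (Qp p)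
  (fun x y => Qp_abs (x - y)) Qp_distxx Qp_dist_eq Qp_dist_sym Qp_dist_triangle.

End Qp.

HB.instance Definition _ (p : nat) :=
  @isMeasurable.Build (sigma_display (@open (Qp p))) (Qp p) <<s @open (Qp p) >>
    (@sigma_algebra0 _ setT _) (@sigma_algebraC _ _)
    (@sigma_algebra_bigcup _ setT _).

Definition Zpadic (p : nat) : set (Qp p) := [set x | Qp_abs x <= 1].
Arguments Zpadic : clear implicits.

(* Unlike the library's closed_ball, this is not the closure of an open ball, *)
(* and for r = 0 it is {x}.                                                   *)
Definition Qp_ball (R : realType) (p : nat) (x : Qp p) (r : R) : set (Qp p) :=
  [set y | ratr (Qp_abs (y - x)) <= r].

(* Normalized Haar measure on the additive group of Q_p. Finiteness on        *)
(* compact sets follows from invariance and mu(Z_p) = 1; regularity is        *)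
(* automatic since Q_p is locally compact and second countable.               *)
Definition is_haar_measure (R : realType) (p : nat)
    (mu : {measure set (Qp p) -> \bar R}) : Prop :=
  (forall (x : Qp p) (A : set (Qp p)), measurable A ->
     mu [set x + y | y in A] = mu A)
  /\ mu (Zpadic p) = 1%E.

(* For r = a/n in lowest terms, max(|a|, |n|). *)
Definition rat_height (r : rat) : nat := maxn `|numq r| `|denq r|.

Section ApproximationSets.
Variables (R : realType) (p : nat).

(* The value of psi at 0 is never used below: psi stands for a function on    *)
(* the positive integers.                                                     *)
Definition Bset (psi : nat -> R) : set (Qp p) :=
  [set alpha | Zpadic p alpha /\
    infinite_set [set r : rat |
      ratr (Qp_abs (alpha - ratr r)) <=
      psi (rat_height r) / (rat_height r)%:R]].

Definition Cset_at (psi : nat -> R) (n : nat) : set (Qp p) :=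
  \bigcup_(a in [set a : int | (`|a| < n)%N && coprime `|a| (p * n)])
    (Qp_ball (n%:R / a%:~R) (psi n / n%:R) `&` Zpadic p).

Definition Cset (psi : nat -> R) : set (Qp p) := lim_sup_set (Cset_at psi).

End ApproximationSets.

Arguments Bset {R} p psi.
Arguments Cset_at {R} p psi n.
Arguments Cset {R} p psi.

(* Main.v *)
Require Import Defs.
From mathcomp Require Import all_boot all_order all_algebra.
From mathcomp Require Import all_classical all_reals all_analysis.
From mathcomp Require Import ring zify.

(** The origin apart, Z_p is the disjoint union of the spheres |x| = p^-k, and
    the k-th sphere has measure (p - 1) p^(-k-1). The theorem amounts to a
    zero-one law on each of them: the set C meets a sphere in a null set or in
    almost all of it (Cset_sphere_zero_full). Any choice of spheres occurs:
    give n = p^k m, with m prime to p, the radius p^(-k-1) if the k-th sphere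
    is chosen and 0 if not (layered_Cset).

    Either the balls of radius at least p^-k that meet the k-th sphere recur
    for ever, and each of them contains the sphere, or eventually a ball around
    n / a meets the sphere only if its centre lies there, so that n = p^k m
    with m prime to p. Then x |-> p^k / x multiplies distances by p^k, maps the
    sphere onto the units, and takes n / a to a / m, where |a| <= p^k m. This
    reduces the law to sets W of points of Z_p that are close to infinitely
    many a / m with m prime to p, a prime to m and |a| <= K m.

    If some lower bound on the radius holds infinitely often, W is all of Z_p,
    because a large m has numerators prime to it in every residue class modulo
    a fixed power of p (coprime_in_residue_class). If the radii tend to 0, two
    facts combine. The measure of W does not change when all radii are
    multiplied by p^j (cassels, an ultrametric form of Cassels' lemma). And if
    x = c + p^j y, with 0 <= c < p^j, is close to a / m, then y is close to
    ((a - c m) / p^j) / m, whose numerator is again prime to m and at most K m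
    in absolute value; so the part of W in a ball B of radius p^-j, magnified
    to Z_p, lies in the set W with radii multiplied by p^j. Together they give
    mu (W `&` B) <= mu W * mu B for every ball B. The same bound follows for
    unions of balls, hence, approximating W by its tails, mu W <= (mu W)^2.

    The set B is the union of C and of the set A coming from fractions a / n
    with |a| <= n (Bset_split). If radii of at least 1 recur for ever, B is Z_p.
    Otherwise the zero-one law applies to A directly. If A has measure 1, so
    has B. If A is null, then inversion of the units shows that C is null on
    the sphere k = 0, whose digit is missing in the second series. Balls of
    radius 0 only contribute rational numbers, which form a null set. *)

Set Implicit Arguments.
Unset Strict Implicit.
Unset Printing Implicit Defensive.

Import Order.TTheory GRing.Theory Num.Theory.
Import numFieldNormedType.Exports.

Local Open Scope classical_set_scope.
Local Open Scope ring_scope.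

(** * Absolute values of p-adic numbers *)

Section AbsoluteValue.
Context (p : nat) (p_prime : prime p).
Implicit Types (x y z : Qp p).

Lemma prime_gt0r (F : numDomainType) : 0 < p%:R :> F.
Proof. by rewrite ltr0n prime_gt0. Qed.

Lemma ler_prime_expV (F : numFieldType) i j :
  (p%:R ^- i <= p%:R ^- j :> F) = (j <= i)%N.
Proof.
rewrite lef_pV2 ?posrE ?exprn_gt0 ?prime_gt0r// -!natrX ler_nat.
by rewrite leq_exp2l ?prime_gt1.
Qed.

Lemma ltr_prime_expV (F : numFieldType) i j :
  (p%:R ^- i < p%:R ^- j :> F) = (j < i)%N.
Proof.
rewrite ltf_pV2 ?posrE ?exprn_gt0 ?prime_gt0r// -!natrX ltr_nat.
by rewrite ltn_exp2l ?prime_gt1.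
Qed.

Lemma prime_expV_gt0 (F : numFieldType) i : 0 < p%:R ^- i :> F.
Proof. by rewrite invr_gt0 exprn_gt0 ?prime_gt0r. Qed.

Lemma prime_expV_le1 (F : numFieldType) i : p%:R ^- i <= 1 :> F.
Proof. by rewrite -[leRHS]invr1 -(expr0 p%:R) ler_prime_expV. Qed.

Lemma Qp_abs_int_le (a : int) l :
  (Qp_abs (a%:~R : Qp p) <= p%:R ^- l) = (p ^ l %| `|a|)%N.
Proof.
rewrite Qp_abs_int; have [->|a0] := eqVneq a 0.
  by rewrite padic_abs0 invr_ge0 exprn_ge0 ?ler0n// dvdn0.
rewrite -[a%:~R]divr1 (@padic_abs_frac p a 1)// logn1 expn0 mul1r.
by rewrite natrX ler_prime_expV pfactor_dvdn// absz_gt0.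
Qed.

Lemma Qp_abs_int_le1 (a : int) : Qp_abs (a%:~R : Qp p) <= 1.
Proof. by have := Qp_abs_int_le a 0; rewrite expr0 invr1 expn0 dvd1n => ->. Qed.

Lemma Qp_abs_int1 (a : int) : coprime p `|a| -> Qp_abs (a%:~R : Qp p) = 1.
Proof.
move=> pa; have a0 : a != 0.
  apply: contraTneq pa => ->; rewrite /coprime absz0 gcdn0.
  by apply: contraL p_prime => /eqP ->.
rewrite Qp_abs_int -[a%:~R]divr1 (@padic_abs_frac p a 1)// logn1 expn0 mul1r.
by rewrite logn_coprime// expn0 invr1.
Qed.

Lemma Qp_abs_nat1 (n : nat) : coprime p n -> Qp_abs (n%:R : Qp p) = 1.
Proof. by move=> /(@Qp_abs_int1 n). Qed.

Lemma Qp_abs_primeX k : Qp_abs (p%:R ^+ k : Qp p) = p%:R ^- k.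
Proof.
rewrite -natrX Qp_abs_nat -[(p ^ k)%:R]divr1.
have -> : ((p ^ k)%:R : rat) = (p ^ k)%N%:~R by [].
rewrite (@padic_abs_frac p (p ^ k)%N 1)//; last first.
  by rewrite -lt0n expn_gt0 prime_gt0.
by rewrite logn1 expn0 mul1r /= pfactorK// natrX.
Qed.

Lemma Qp_abs_ratio x : x != 0 ->
  exists i j : nat, Qp_abs x = p%:R ^+ i / p%:R ^+ j.
Proof.
rewrite -[x]Qp_seqK => /Qp_lim_abs_eventually[N /(_ N (leqnn N))[<- u0]].
by rewrite /padic_abs (negPf u0) !natrX; eexists; eexists; reflexivity.
Qed.

(** The absolute value is discrete: no value lies strictly between two
    consecutive powers of p. *)
Lemma Qp_abs_ltS x l : (Qp_abs x < p%:R ^- l) = (Qp_abs x <= p%:R ^- l.+1).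
Proof.
have [->|/Qp_abs_ratio[i [j ->]]] := eqVneq x 0.
  by rewrite Qp_abs0 prime_expV_gt0 ltW// prime_expV_gt0.
have p0 := prime_gt0r rat.
rewrite ltr_pdivrMr ?exprn_gt0// ler_pdivrMr ?exprn_gt0//.
rewrite [_ ^- l * _]mulrC [_ ^- l.+1 * _]mulrC.
rewrite ltr_pdivlMr ?exprn_gt0// ler_pdivlMr ?exprn_gt0//.
by rewrite -!exprD -!natrX ltr_nat ler_nat ltn_exp2l ?leq_exp2l ?prime_gt1//
  addnS.
Qed.

Lemma Qp_abs_level x : x != 0 -> Qp_abs x <= 1 ->
  exists k, Qp_abs x = p%:R ^- k.
Proof.
move=> /Qp_abs_ratio[i [j ->]].
rewrite ler_pdivrMr ?exprn_gt0 ?prime_gt0r// mul1r -!natrX ler_nat.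
rewrite leq_exp2l ?prime_gt1// => ij; exists (j - i)%N.
have p0 : p%:R != 0 :> rat by rewrite gt_eqF ?prime_gt0r.
rewrite !natrX -[in LHS](subnK ij) exprD invfM mulrCA mulfV ?expf_neq0//.
by rewrite mulr1.
Qed.

Lemma Qp_abs_maxl x y r : Qp_abs x <= r -> Qp_abs y <= r -> Qp_abs (x + y) <= r.
Proof.
by move=> xr yr; rewrite (le_trans (Qp_abs_max _ _))// ge_max xr yr.
Qed.

Lemma Qp_abs_maxB x y r : Qp_abs x <= r -> Qp_abs y <= r -> Qp_abs (x - y) <= r.
Proof. by move=> xr yr; rewrite Qp_abs_maxl// Qp_absN. Qed.

Lemma Qp_abs_dominant x y : Qp_abs (x - y) < Qp_abs x -> Qp_abs y = Qp_abs x.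
Proof.
move=> h; apply/eqP; rewrite eq_le; apply/andP; split.
  have -> : y = x - (x - y) by rewrite subKr.
  by rewrite Qp_abs_maxB// ltW.
rewrite leNgt; apply/negP => yx.
have := Qp_abs_max (x - y) y; rewrite subrK => /le_lt_trans.
by move/(_ (Qp_abs x)); rewrite gt_max h yx ltxx => /(_ isT).
Qed.

(** The late terms of a Cauchy sequence approximate its class. *)
Lemma Qp_rat_dense x l : exists q : rat, Qp_abs (x - ratr q) <= p%:R ^- l.
Proof.
have ratE (q : rat) : ratr q = Qp_lim (CauchySeq (padic_cauchy_cst p q)).
  have intE (n : int) : (n%:~R : Qp p) =
      Qp_lim (CauchySeq (padic_cauchy_cst p n%:~R)).
    have natE (m : nat) : (m%:R : Qp p) =
        Qp_lim (CauchySeq (padic_cauchy_cst p m%:R)).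
      elim: m => [|m IHm]; first by rewrite mulr0n -[LHS]Qp_lim0; congr Qp_lim; apply: val_inj.
      rewrite mulrSr IHm -Qp_lim1 -Qp_limD; congr Qp_lim; apply: val_inj.
      by apply/funext => k; rewrite [RHS]/= mulrSr.
    case: n => n; first exact: natE.
    rewrite NegzE !mulrNz -!pmulrn natE -Qp_limN; congr Qp_lim.
    exact: val_inj.
  rewrite /ratr !intE.
  have d0 : (denq q)%:~R != 0 :> Qp p.
    rewrite -Qp_abs_eq0 Qp_abs_int padic_abs_eq0 intr_eq0.
    exact: denq_neq0.
  rewrite intE in d0; apply: (mulIf d0); rewrite mulfVK// -Qp_limM.
  congr Qp_lim; apply: val_inj; apply/funext => k.
  exact: (numqE q).
pose u := Qp_seq x; have := cauchy_valP u.
move=> /padic_cauchyP/(_ _ (prime_expV_gt0 rat l))[N hN].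
exists (u N); rewrite ratE -[x]Qp_seqK -/u -Qp_limN -Qp_limD.
have [->|/Qp_lim_abs_eventually[M hM]] :=
    eqVneq (Qp_lim (u - CauchySeq (padic_cauchy_cst p (u N)))) 0.
  by rewrite Qp_abs0 ltW ?prime_expV_gt0.
have [<- _] := hM (maxn N M) (leq_maxr _ _).
exact/ltW/(hN (maxn N M) N (leq_maxl _ _) (leqnn N)).
Qed.

(** A rational approximation of x of absolute value at most 1 has a denominator
    prime to p, which is invertible modulo every power of p. *)
Lemma Zpadic_residue x l : Qp_abs x <= 1 ->
  exists2 i : nat, (i < p ^ l)%N & Qp_abs (x - i%:R) <= p%:R ^- l.
Proof.
move=> x1; have [q xq] := Qp_rat_dense x l.
have q1 : Qp_abs (ratr q : Qp p) <= 1.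
  rewrite -[ratr q](subKr x) Qp_abs_maxB// (le_trans xq)//.
  exact: prime_expV_le1.
have pd : coprime p `|denq q|.
  rewrite prime_coprime//; apply/negP => pd.
  have pn : ~~ (p %| `|numq q|)%N.
    apply/negP => pn; have := coprime_num_den q.
    rewrite /coprime => /eqP gq; have : (p %| 1)%N by rewrite -gq dvdn_gcd pn.
    by rewrite dvdn1 => /eqP p1; move: p_prime; rewrite p1.
  have n0 : numq q != 0 by apply: contraNneq pn => ->; rewrite absz0 dvdn0.
  move: q1; rewrite Qp_abs_rat /padic_abs -numq_eq0 (negPf n0).
  rewrite (@logn_coprime p `|numq q|) ?prime_coprime// expn0 divr1.
  rewrite leNgt ltr1n => /negP; apply.
  by rewrite -(expn0 p) ltn_exp2l ?prime_gt1// logn_gt0 mem_primes p_prime pd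
    absz_gt0 denq_neq0.
have /eqP: coprime (p ^ l) `|denq q| by rewrite coprimeXl.
have d0 : (0 < `|denq q|)%N by rewrite absz_gt0 denq_neq0.
have [u v uv _ g1] := egcdnP (p ^ l) d0.
rewrite gcdnC g1 in uv.
pose j : int := (numq q * u%:Z %% (p ^ l)%N)%Z.
have j0 : 0 <= j by rewrite modz_ge0// -lt0n expn_gt0 prime_gt0.
have jl : j < (p ^ l)%N by rewrite ltz_pmod// ltz_nat expn_gt0 prime_gt0.
have jE : j = `|j|%N by rewrite gez0_abs.
exists `|j|%N; first by rewrite -ltz_nat -jE.
have -> : x - `|j|%:R = (x - ratr q) + (ratr q - j%:~R) by rewrite {2}jE addrA subrK.
apply: Qp_abs_maxl => //.
have d1 : Qp_abs ((denq q)%:~R : Qp p) = 1 by exact: Qp_abs_int1.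
have dn0 : (denq q)%:~R != 0 :> Qp p by rewrite -Qp_abs_eq0 d1 oner_eq0.
have -> : Qp_abs (ratr q - j%:~R : Qp p) =
    Qp_abs ((ratr q - j%:~R) * (denq q)%:~R : Qp p) by rewrite Qp_absM d1 mulr1.
rewrite mulrBl divfK// -intrM -intrB.
rewrite Qp_abs_int_le; change (Posz (p ^ l) %| numq q - j * denq q)%Z.
have -> : numq q - j * denq q =
    ((numq q * u%:Z - j) * denq q - numq q * (u%:Z * denq q - 1)) by ring.
apply: rpredB; first by apply/dvdz_mulr; rewrite -eqz_mod_dvd modz_mod.
apply/dvdz_mull; have -> : denq q = `|denq q|%N by rewrite gez0_abs// denq_ge0.
by rewrite -PoszM uv PoszD addrK PoszM dvdz_mull.
Qed.

Lemma nat_residue_inj l i j : (i < p ^ l)%N -> (j < p ^ l)%N ->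
  Qp_abs (i%:R - j%:R : Qp p) <= p%:R ^- l -> i = j.
Proof.
move=> il jl.
have -> : i%:R - j%:R = (i%:Z - j%:Z)%:~R :> Qp p by rewrite intrB.
rewrite Qp_abs_int_le.
change ((Posz (p ^ l) %| i%:Z - j%:Z)%Z -> i = j).
by rewrite -eqz_mod_dvd !modz_nat !modn_small// => /eqP[].
Qed.

End AbsoluteValue.

(** * Balls, level sets and their measure *)

Definition lball (p l : nat) (c : Qp p) : set (Qp p) :=
  [set y | Qp_abs (y - c) <= p%:R ^- l].

(** Unions of cosets of p^l Z_p. *)
Definition level_set (p l : nat) (U : set (Qp p)) : Prop :=
  forall x y, U x -> Qp_abs (y - x) <= p%:R ^- l -> U y.

Definition sphere (p k : nat) : set (Qp p) := [set x | Qp_abs x = p%:R ^- k].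
Arguments sphere : clear implicits.

Section LevelSets.
Context (p : nat) (p_prime : prime p).
Implicit Types (x y z c : Qp p) (U V : set (Qp p)).

Lemma lball_center l c : lball l c c.
Proof. by rewrite /lball/= subrr Qp_abs0 ltW// prime_expV_gt0. Qed.

Lemma lball_level l c : level_set l (lball l c).
Proof.
by move=> x y xc yx; rewrite /lball/= -(subrK x y) -addrA Qp_abs_maxl.
Qed.

Lemma level_set_lball l U c : level_set l U -> U c -> lball l c `<=` U.
Proof. by move=> lU Uc y; exact: lU. Qed.

Lemma lball_sym l c d : lball l c d -> lball l d c.
Proof. by rewrite /lball/= -Qp_absN opprB. Qed.

Lemma lball_eq l c d : lball l c d -> lball l c = lball l d.
Proof.
move=> cd; apply/seteqP; split; apply: level_set_lball; try exact: lball_level.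
  exact: lball_sym.
by [].
Qed.

Lemma level_set_le l m U : (l <= m)%N -> level_set l U -> level_set m U.
Proof.
move=> lm lU x y Ux yx; apply: lU Ux _; apply: le_trans yx _.
by rewrite ler_prime_expV.
Qed.

Lemma lballS l m c : (l <= m)%N -> lball m c `<=` lball l c.
Proof.
move=> lm; apply: level_set_lball; last exact: lball_center.
by apply: level_set_le lm _; exact: lball_level.
Qed.

Lemma Zpadic_lball : Zpadic p = lball 0 0.
Proof. by apply/funext => x; rewrite /Zpadic /lball/= subr0 expr0 invr1. Qed.

Lemma Zpadic_level l : level_set l (Zpadic p).
Proof.
by apply: (level_set_le (leq0n l)); rewrite Zpadic_lball; exact: lball_level.
Qed.

Lemma Zpadic_nat (n : nat) : Zpadic p n%:R.
Proof. exact: Qp_abs_int_le1 p_prime n. Qed.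

Lemma sphere_level k : level_set k.+1 (sphere p k).
Proof.
move=> x y xk; rewrite -Qp_abs_ltS// -xk -Qp_absN opprB => /Qp_abs_dominant.
by rewrite /sphere/= xk.
Qed.

Lemma sphere_Zpadic k : sphere p k `<=` Zpadic p.
Proof. by move=> x; rewrite /sphere/= /Zpadic/= => ->; exact: prime_expV_le1. Qed.

Lemma sphere_neq0 k x : sphere p k x -> x != 0.
Proof. by rewrite -Qp_abs_eq0 => ->; rewrite gt_eqF// prime_expV_gt0. Qed.

Lemma sphere_inj i j x : sphere p i x -> sphere p j x -> i = j.
Proof.
move=> xi xj; have ij : p%:R ^- i = p%:R ^- j :> rat by rewrite -xi -xj.
by apply/eqP; rewrite eqn_leq -!(ler_prime_expV p_prime rat) ij lexx.
Qed.

Lemma level_setC l U : level_set l U -> level_set l (~` U).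
Proof.
move=> lU x y Ux yx Uy; apply: Ux; apply: lU Uy _.
by rewrite -Qp_absN opprB.
Qed.

Lemma level_setI l U V : level_set l U -> level_set l V -> level_set l (U `&` V).
Proof.
by move=> lU lV x y [Ux Vx] yx; split; [exact: lU yx|exact: lV yx].
Qed.

Lemma level_set_bigcup l (I : Type) (P : set I) (F : I -> set (Qp p)) :
  (forall i, P i -> level_set l (F i)) -> level_set l (\bigcup_(i in P) F i).
Proof. by move=> lF x y [i Pi Fx] yx; exists i => //; exact: lF yx. Qed.

Lemma level_set_open l U : level_set l U -> open U.
Proof.
move=> lU; rewrite openE => x Ux; apply/nbhs_ballP.
exists (p%:R ^- l); first exact: prime_expV_gt0.
by move=> y xy; apply: lU Ux _; rewrite Qp_dist_sym; exact: ltW xy.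
Qed.

Lemma open_measurable_Qp U : open U -> measurable U.
Proof. by move=> oU; exact: sub_sigma_algebra. Qed.

Lemma level_set_measurable l U : level_set l U -> measurable U.
Proof. by move/level_set_open; exact: open_measurable_Qp. Qed.

Lemma lball_measurable l c : measurable (lball l c).
Proof. by apply: (@level_set_measurable l); exact: lball_level. Qed.

Lemma Zpadic_measurable : measurable (Zpadic p).
Proof. by apply: (@level_set_measurable 0); exact: Zpadic_level. Qed.

Lemma sphere_measurable k : measurable (sphere p k).
Proof. by apply: (@level_set_measurable k.+1); exact: sphere_level. Qed.

(** Two balls are nested or disjoint, so these sets form a pi-system. The lower
    bound on the level leaves only balls small enough to be compared inside a
    given level set. *)
Definition balls_from (J : nat) : set (set (Qp p)) :=
  [set A | A = set0 \/ exists l c, (J <= l)%N /\ A = lball l c].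

Lemma balls_from_setI J : setI_closed (balls_from J).
Proof.
move=> A B [->|[l [c [Jl ->]]]]; first by rewrite set0I; left.
move=> [->|[m [d [Jm ->]]]]; first by rewrite setI0; left.
have [|/set0P[z [zc zd]]] := eqVneq (lball l c `&` lball m d) set0.
  by move=> ->; left.
right; rewrite (lball_eq zc) (lball_eq zd).
have [lm|/ltnW lm] := leqP l m.
  by exists m, z; split=> //; rewrite setIidr//; exact: lballS.
by exists l, z; split=> //; rewrite setIidl//; exact: lballS.
Qed.

Lemma prime_expV_small (e : rat) : 0 < e -> exists l, p%:R ^- l < e.
Proof.
move=> e0; have [n] : exists n : nat, e^-1 < n%:R.
  by exists (Num.bound e^-1); rewrite archi_boundP// invr_ge0 ltW.
move=> en; exists n; rewrite invf_plt ?posrE ?exprn_gt0 ?prime_gt0r//.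
apply: lt_trans en _; rewrite -natrX ltr_nat.
exact: ltn_expl (prime_gt1 p_prime).
Qed.

Lemma rat_enum : exists e : nat -> rat, forall q, exists k, e k = q.
Proof.
exists (fun k => odflt 0 (unpickle k)) => q; exists (pickle q).
by rewrite pickleK.
Qed.

(** An open set is the union of the balls with rational centres and level at
    least J that it contains, and these balls are countably many. *)
Lemma measurable_balls J :
  @measurable _ (Qp p) = <<s balls_from J >>.
Proof.
apply/seteqP; split; apply: smallest_sub.
- exact: smallest_sigma_algebra.
- move=> U oU; pose F (q : rat) (l : nat) : set (Qp p) :=
    if `[< (J <= l)%N /\ lball l (ratr q) `<=` U >] then lball l (ratr q) else set0.
  have mF q l : <<s balls_from J >> (F q l).
    rewrite /F; case: asboolP => [[Jl _]|_].
      by apply: sub_sigma_algebra; right; exists l, (ratr q).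
    by apply: sub_sigma_algebra; left.
  have [e eP] := rat_enum.
  have -> : U = \bigcup_k \bigcup_l F (e k) l.
    apply/seteqP; split => x.
      move=> Ux; move: oU; rewrite openE => /(_ x Ux)/nbhs_ballP[r /= r0 rU].
      have [l lr] := prime_expV_small r0; pose m := maxn J l.
      have [q xq] := Qp_rat_dense p_prime x m.
      have [k kq] := eP q.
      exists k => //; exists m => //; rewrite kq /F asboolT//.
      split; first exact: leq_maxl.
      rewrite (@lball_eq m (ratr q) x xq) => y yx; apply: rU.
      rewrite /ball/=; apply: le_lt_trans lr.
      rewrite Qp_dist_sym; apply: le_trans yx _.
      by rewrite ler_prime_expV// leq_maxr.
    by move=> [k _ [l _]]; rewrite /F; case: asboolP => // -[_]; exact.
  have [_ _ bigc] := @smallest_sigma_algebra _ setT (balls_from J).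
  by apply: (bigc) => k; apply: (bigc) => l; exact: mF.
- exact: sigma_algebra_measurable.
- move=> A [->|[l [c [_ ->]]]]; first exact: measurable0.
  exact: lball_measurable.
Qed.

End LevelSets.

Section HaarBalls.
Context (R : realType) (p : nat) (p_prime : prime p).
Context (mu : {measure set (Qp p) -> \bar R}) (mu_haar : is_haar_measure mu).
Implicit Types (c : Qp p) (A U X : set (Qp p)).
Local Open Scope ereal_scope.

Lemma measure_residue_split l A : measurable A -> A `<=` Zpadic p ->
  mu A = \sum_(i < p ^ l) mu (A `&` lball l (i%:R : Qp p)).
Proof.
move=> mA AZ.
have AE : A = \big[setU/set0]_(i < p ^ l) (A `&` lball l (i%:R : Qp p)).
  rewrite -(bigcup_mkord _ (fun i => A `&` lball l (i%:R : Qp p))).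
  apply/seteqP; split => x; last by move=> [i _ []].
  move=> Ax; have [i il xi] := Zpadic_residue p_prime l (AZ x Ax).
  by exists i.
rewrite {1}AE measure_semi_additive_ord//.
- by move=> i; apply: measurableI => //; exact: lball_measurable.
- move=> i j _ _ [x [[_ xi] [_ xj]]]; apply: val_inj.
  apply: (nat_residue_inj p_prime (ltn_ord i) (ltn_ord j)).
  have -> : ((i%:R - j%:R)%R : Qp p) = ((x - j%:R) - (x - i%:R))%R.
    by ring.
  exact: Qp_abs_maxB.
- by rewrite -AE.
Qed.

(** The p^l residue classes modulo p^l partition Z_p and are translates of one
    another. *)
Lemma haar_lball l c : mu (lball l c) = (p%:R ^- l)%:E.
Proof.
have [mu_tr mu1] := mu_haar.
have tr d : mu (lball l d) = mu (lball l 0%R).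
  rewrite -(mu_tr d (lball l 0%R)); last exact: lball_measurable.
  congr (mu _).
  apply/seteqP; split => x.
    by exists (x - d)%R; rewrite /lball/= ?subr0// addrC subrK.
  by move=> [y]; rewrite /lball/= subr0 => yl <-; rewrite addrAC subrr add0r.
have fin : mu (lball l 0%R) \is a fin_num.
  rewrite ge0_fin_numE//; have : mu (lball l 0%R) <= mu (Zpadic p).
    apply: le_measure; rewrite ?inE; [exact: lball_measurable|exact: Zpadic_measurable|].
    by rewrite Zpadic_lball; exact: lballS.
  by rewrite mu1 => /le_lt_trans; apply; rewrite ltry.
have := measure_residue_split l (Zpadic_measurable p_prime) (@subset_refl _ _).
rewrite mu1.
under eq_bigr => i _.
  rewrite setIidr; last first.
    apply: level_set_lball (Zpadic_nat p_prime _).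
    exact: Zpadic_level.
  rewrite tr -(fineK fin); over.
rewrite sumEFin sumr_const card_ord => -[].
rewrite -[X in X = _]/(1%R) -(mulr_natl (fine _)) natrX => H.
rewrite tr -(fineK fin).
congr EFin; apply/esym/(@mulfI _ (p%:R ^+ l)%R).
  by rewrite expf_neq0// gt_eqF// prime_gt0r.
by rewrite -H mulfV// expf_neq0// gt_eqF// prime_gt0r.
Qed.

Lemma le_mu A B : measurable A -> measurable B -> A `<=` B -> mu A <= mu B.
Proof. by move=> mA mB AB; apply: le_measure; rewrite ?inE. Qed.

Lemma haar_Zpadic_le1 A : measurable A -> A `<=` Zpadic p -> mu A <= 1.
Proof.
move=> mA AZ; have [_ <-] := mu_haar.
by apply: le_mu => //; exact: Zpadic_measurable.
Qed.

Lemma haar_Zpadic_fin A : measurable A -> A `<=` Zpadic p -> mu A \is a fin_num.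
Proof.
move=> mA AZ; rewrite ge0_fin_numE//; apply: le_lt_trans (ltry 1).
exact: haar_Zpadic_le1.
Qed.

(** Both sides split over the residues modulo p^l, and U contains each residue
    class entirely or not at all. *)
Lemma level_set_mean_ge l U X (q : R) : (0 <= q)%R ->
  level_set l U -> U `<=` Zpadic p -> measurable X ->
  (forall c, U c -> q%:E * mu (lball l c) <= mu (X `&` lball l c)) ->
  q%:E * mu U <= mu (X `&` U).
Proof.
move=> q0 lU UZ mX h.
have mU := level_set_measurable p_prime lU.
rewrite (measure_residue_split l mU UZ).
rewrite (@measure_residue_split l (X `&` U)); last 2 first.
- exact: measurableI.
- by move=> x [_ /UZ].
rewrite ge0_sume_distrr//; apply: lee_sum => i _.
have [->|/set0P[c [Uc ci]]] := eqVneq (U `&` lball l (i%:R : Qp p)) set0.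
  by rewrite measure0 mule0.
by rewrite -setIA (lball_eq ci) (setIidr (level_set_lball lU Uc)) h.
Qed.

Lemma level_set_mean_le l U X (q : \bar R) : 0 <= q ->
  level_set l U -> U `<=` Zpadic p -> measurable X ->
  (forall c, U c -> mu (X `&` lball l c) <= q * mu (lball l c)) ->
  mu (X `&` U) <= q * mu U.
Proof.
move=> q0 lU UZ mX h.
have mU := level_set_measurable p_prime lU.
rewrite (measure_residue_split l mU UZ).
rewrite (@measure_residue_split l (X `&` U)); last 2 first.
- exact: measurableI.
- by move=> x [_ /UZ].
rewrite ge0_sume_distrr//; apply: lee_sum => i _.
have [e|/set0P[c [Uc ci]]] := eqVneq (U `&` lball l (i%:R : Qp p)) set0.
  by rewrite -setIA e setI0 measure0 mule0.
by rewrite -setIA (lball_eq ci) (setIidr (level_set_lball lU Uc)) h.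
Qed.

End HaarBalls.

(** * Similarities *)

Section Similarity.
Context (R : realType) (p : nat) (p_prime : prime p).
Context (mu : {measure set (Qp p) -> \bar R}) (mu_haar : is_haar_measure mu).
Context (u v : nat) (D D' : set (Qp p)) (f : Qp p -> Qp p).
Hypotheses (lD : level_set u D) (DZ : D `<=` Zpadic p).
Hypothesis lD' : level_set v D'.
Hypothesis fD : forall x, D x -> D' (f x).
Hypothesis fD' : forall y, D' y -> exists2 x, D x & f x = y.
Hypothesis f_dist : forall x y i, D x -> D y ->
  (Qp_abs (f x - f y) <= p%:R ^- (v + i)) = (Qp_abs (x - y) <= p%:R ^- (u + i)).
Local Open Scope ereal_scope.

Let mD : measurable D := level_set_measurable p_prime lD.
Let mD' : measurable D' := level_set_measurable p_prime lD'.

Let preimage_lball x i : D x ->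
  D `&` f @^-1` lball (v + i) (f x) = lball (u + i) x.
Proof.
move=> Dx; apply/seteqP; split => y.
  by move=> [Dy]; rewrite /lball/= f_dist.
move=> yx; have Dy : D y.
  apply: level_set_lball yx; [apply: level_set_le lD|] => //.
  exact: leq_addr.
by split=> //; rewrite /lball/= f_dist.
Qed.

Lemma similarity_measurable : measurable_fun D f.
Proof.
apply: (@measurability _ _ _ _ D f _ (measurable_balls p_prime v)).
move=> _ [B [->|[l [c [vl ->]]]] <-].
  by rewrite preimage_set0 setI0.
have [->//|/set0P[x [Dx xc]]] := eqVneq (D `&` f @^-1` lball l c) set0.
rewrite (lball_eq xc) -(subnKC vl) preimage_lball//.
exact: lball_measurable.
Qed.

(** As functions of S both sides are measures, and they agree on the balls of
    level at least v: f pulls such a ball inside D' back to a ball inside D, of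
    level shifted by u - v. Balls of this kind determine a measure. *)
Lemma haar_similarity (S : set (Qp p)) : measurable S ->
  (p%:R ^+ u)%:E * mu (D `&` f @^-1` S) = (p%:R ^+ v)%:E * mu (D' `&` S).
Proof.
have pX_ge0 i : (0 <= p%:R ^+ i :> R)%R by rewrite exprn_ge0.
have pVK i j : (p%:R ^+ i * p%:R ^- (i + j) = p%:R ^- j :> R)%R.
  by rewrite exprD invfM mulrA mulfV ?mul1r// expf_neq0// gt_eqF// prime_gt0r.
have mf : measurable_fun setT (f \_ D).
  by apply/(measurable_restrictT _ mD); exact: similarity_measurable.
pose m1 := mscale (NngNum (pX_ge0 u))
  (measure_function_pushforward__canonical__measure_function_Measure
     (mrestr mu mD) mf).
pose m2 := mscale (NngNum (pX_ge0 v)) (mrestr mu mD').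
have m1E A : m1 A = (p%:R ^+ u)%:E * mu (D `&` f @^-1` A).
  rewrite /m1 /mscale/= /pushforward /mrestr; congr (_ * mu _).
  apply/seteqP; split => x /= [].
    by rewrite patchE => + Dx; rewrite mem_set.
  by move=> Dx fx; split=> //; rewrite patchE mem_set.
have m2E A : m2 A = (p%:R ^+ v)%:E * mu (D' `&` A).
  by rewrite /m2 /mscale/= /mrestr setIC.
move=> mS; rewrite -m1E -m2E.
have [e eP] := rat_enum.
apply: (measure_unique (balls_from v) (fun k => lball v (ratr (e k)))) => //.
- exact: measurable_balls.
- exact: balls_from_setI.
- by move=> k; right; exists v, (ratr (e k)).
- apply/seteqP; split => // x _.
  have [q xq] := Qp_rat_dense p_prime x v.
  by have [k kq] := eP q; exists k => //; rewrite kq.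
- move=> A [->|[l [c [vl ->]]]]; first by rewrite !measure0.
  rewrite -[LHS]/(m1 _) -[RHS]/(m2 _) m1E m2E.
  have [D'0|/set0P[y [D'y yc]]] := eqVneq (D' `&` lball l c) set0.
    rewrite D'0 (_ : D `&` _ = set0) ?measure0 ?mule0//.
    apply/seteqP; split => // x [Dx fx].
    by suff : set0 (f x) by []; rewrite -D'0; split; first exact: fD.
  have [x Dx fx] := fD' D'y.
  rewrite (lball_eq yc) -fx -(subnKC vl) preimage_lball//.
  rewrite (@setIidr _ D'); last first.
    apply: level_set_lball; last exact: fD.
    by apply: level_set_le lD' => //; exact: leq_addr.
  by rewrite !(haar_lball p_prime mu_haar) -!EFinM !pVK.
- move=> k; rewrite -[X in X < _]/(m1 _) m1E.
  have mDf : measurable (D `&` f @^-1` lball v (ratr (e k))).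
    by apply: similarity_measurable => //; exact: lball_measurable.
  rewrite lte_mul_pinfty//.
  apply: le_lt_trans (ltry 1).
  apply: (haar_Zpadic_le1 p_prime mu_haar) => //.
  by move=> x [/DZ].
Qed.

End Similarity.

(** * Limit superior sets and Cassels' lemma *)

Section LimSup.
Context (R : realType) (p : nat) (p_prime : prime p).
Context (mu : {measure set (Qp p) -> \bar R}) (mu_haar : is_haar_measure mu).
Implicit Types (U V X : set (Qp p)) (F G : (set (Qp p))^nat).
Local Open Scope ereal_scope.

Lemma mu_setDI A B : measurable A -> measurable B ->
  mu A = mu (A `\` B) + mu (A `&` B).
Proof. exact: measureDI. Qed.

Lemma mu_setD A B : measurable A -> measurable B -> A `<=` Zpadic p ->
  mu (A `\` B) = mu A - mu (A `&` B).
Proof.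
move=> mA mB AZ; apply: measureD => //.
by apply: le_lt_trans (ltry 1); exact: (haar_Zpadic_le1 p_prime mu_haar).
Qed.

Lemma lim_sup_set_measurable F :
  (forall n, measurable (F n)) -> measurable (lim_sup_set F).
Proof.
move=> mF; apply: bigcapT_measurable => N; apply: bigcup_measurable => k _.
exact: mF.
Qed.

Lemma lim_sup_setI F U : lim_sup_set (fun n => F n `&` U) = lim_sup_set F `&` U.
Proof.
apply/seteqP; split => x.
  move=> FU; split; last by have [n _ []] := FU 0%N I.
  by move=> N _; have [n Nn [Fx Ux]] := FU N I; exists n.
by move=> [Fx Ux] N _; have [n Nn Fnx] := Fx N I; exists n.
Qed.

Lemma tail_cvg F : (forall n, measurable (F n)) ->
  (forall n, F n `<=` Zpadic p) ->
  mu (\bigcup_(j in [set j | n <= j]%N) F j) @[n --> \oo] --> mu (lim_sup_set F).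
Proof.
move=> mF FZ; apply: lim_sup_set_cvg => //.
apply: le_lt_trans (ltry 1); apply: (haar_Zpadic_le1 p_prime mu_haar).
  exact: bigcup_measurable.
by move=> x [j _ /FZ].
Qed.

Lemma block_cvg F X N : measurable X -> (forall n, measurable (F n)) ->
  mu (X `&` \bigcup_(j in [set j | N <= j < K]%N) F j) @[K --> \oo] -->
  mu (X `&` \bigcup_(j in [set j | N <= j]%N) F j).
Proof.
move=> mX mF.
have mV K : measurable (\bigcup_(j in [set j | N <= j < K]%N) F j).
  exact: bigcup_measurable.
have -> : X `&` \bigcup_(j in [set j | N <= j]%N) F j =
    \bigcup_K (X `&` \bigcup_(j in [set j | N <= j < K]%N) F j).
  apply/seteqP; split => x.
    by move=> [Xx [j /= Nj Fx]]; exists j.+1 => //; split=> //; exists j => /=;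
      rewrite ?Nj ?ltnSn.
  by move=> [K _ [Xx [j /= /andP[Nj _] Fx]]]; split=> //; exists j.
apply: nondecreasing_cvg_mu.
- by move=> K; exact: measurableI.
- by apply: bigcupT_measurable => K; exact: measurableI.
- move=> K L KL; apply/subsetPset => x [Xx [j /= /andP[Nj jK] Fx]].
  by split=> //; exists j => //=; rewrite Nj (leq_trans jK KL).
Qed.

Lemma block_level F (l : nat -> nat) N K :
  (forall n, level_set (l n) (F n)) ->
  exists m, level_set m (\bigcup_(j in [set j | N <= j < K]%N) F j).
Proof.
move=> lF; exists (\max_(j < K) l j); apply: level_set_bigcup => j /= /andP[_ jK].
apply: level_set_le (lF j) => //.
exact: (@leq_bigmax_cond _ xpredT (fun i : 'I_K => l i) (Ordinal jK)).
Qed.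

(** A lim sup set is approximated from outside by its own tails, and these from
    inside by finite blocks, which are level sets. *)
Lemma lim_sup_level_le F (l : nat -> nat) (t : R) : (0 <= t)%R ->
  (forall n, level_set (l n) (F n)) -> (forall n, F n `<=` Zpadic p) ->
  (forall m V, level_set m V -> V `<=` Zpadic p ->
    mu (lim_sup_set F `&` V) <= t%:E * mu V) ->
  mu (lim_sup_set F) <= t%:E * mu (lim_sup_set F).
Proof.
move=> t0 lF FZ h.
have mF n : measurable (F n) by apply: level_set_measurable (lF n).
have mW := lim_sup_set_measurable mF.
have tail_le N :
    mu (lim_sup_set F) <= t%:E * mu (\bigcup_(j in [set j | N <= j]%N) F j).
  rewrite -[X in mu X <= _](@setIidl _ _ (\bigcup_(j in [set j | N <= j]%N) F j)).
    apply: (cvge_to_le (block_cvg (N := N) mW mF)); near=> K.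
    have [m lV] := block_level N K lF.
    apply: le_trans (h m _ lV _) _; first by move=> x [j _ /FZ].
    rewrite lee_wpmul2l ?lee_fin//; apply: le_mu.
    - exact: bigcup_measurable.
    - exact: bigcup_measurable.
    - by move=> x [j /= /andP[Nj _] Fx]; exists j.
  by move=> x /(_ N I).
have /cvge_to_ge : t%:E * mu (\bigcup_(j in [set j | N <= j]%N) F j) @[N --> \oo]
    --> t%:E * mu (lim_sup_set F) by apply: cvgeZl => //; exact: tail_cvg.
by apply; near=> N; exact: (tail_le N).
Unshelve. all: by end_near.
Qed.

Section Cassels.
Context (F G : (set (Qp p))^nat) (l : nat -> nat).
Hypotheses (GZ : forall n, G n `<=` Zpadic p) (FG : forall n, F n `<=` G n).
Hypotheses (lG : forall n, level_set (l n) (G n)).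
Hypotheses (lF : forall n, level_set (l n).+1 (F n)).
Hypothesis FG_near : forall n c, G n c -> exists2 d, F n d & lball (l n) c d.
Hypothesis l_oo : forall J, exists N, forall n, (N <= n)%N -> (J <= l n)%N.

Let mF n : measurable (F n) := level_set_measurable p_prime (lF (n := n)).
Let mG n : measurable (G n) := level_set_measurable p_prime (lG (n := n)).
Let FZ n : F n `<=` Zpadic p. Proof. exact: subset_trans (FG (n := n)) _. Qed.

(** The balls that make up the G n, grouped by radius, with those contained in
    larger ones discarded, partition a tail of G; the tail of F fills at least
    a p-th of each of them. *)
Let cassels_tail J U N : level_set J U ->
  (forall n, (N <= n)%N -> (J <= l n)%N) ->
  (p%:R^-1)%:E * mu (\bigcup_(n in [set n | N <= n]%N) (G n `&` U)) <=
  mu (\bigcup_(n in [set n | N <= n]%N) (F n `&` U)).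
Proof.
move=> lU NJ; have mU := level_set_measurable p_prime lU.
set X := \bigcup_(n in _) (F n `&` U).
have mX : measurable X by apply: bigcup_measurable => n _; exact: measurableI.
have p0 : (0 <= p%:R^-1 :> R)%R by rewrite invr_ge0.
pose H m := \bigcup_(n in [set n | (N <= n)%N /\ l n = m]) (G n `&` U).
have lH m : level_set m (H m).
  apply: level_set_bigcup => n [Nn <-]; apply: level_setI => //.
  by apply: level_set_le lU => //; exact: NJ.
pose D := seqDU H.
have lD m : level_set m (D m).
  rewrite /D /seqDU setDE -bigcup_mkord; apply: level_setI => //.
  apply: level_setC; apply: level_set_bigcup => i /= im.
  by apply: level_set_le (lH i) => //; exact: ltnW.
have mD m : measurable (D m) by apply: level_set_measurable (lD m).
have DH m : D m `<=` H m by move=> x [].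
have HZ m : H m `<=` Zpadic p by move=> x [n _ [/GZ]].
have -> : \bigcup_(n in [set n | N <= n]%N) (G n `&` U) = \bigcup_m D m.
  rewrite -seqDU_bigcup_eq; apply/seteqP; split => x.
    by move=> [n Nn GUx]; exists (l n) => //; exists n.
  by move=> [m _ [n [Nn _] GUx]]; exists n.
have D_le m : (p%:R^-1)%:E * mu (D m) <= mu (X `&` D m).
  apply: (level_set_mean_ge p_prime p0 (lD m)) => //; first exact: subset_trans (DH m) _.
  move=> c /DH[n [Nn <-] [Gc Uc]]; have [d Fd cd] := FG_near Gc.
  rewrite (haar_lball p_prime mu_haar) -EFinM -invfM -exprS.
  rewrite -(haar_lball p_prime mu_haar _ d); apply: le_mu.
  - exact: lball_measurable.
  - by apply: measurableI => //; exact: lball_measurable.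
  move=> x xd; have cx : lball (l n) c x.
    by rewrite (lball_eq cd); apply: lballS xd.
  split=> //; exists n => //; split; first exact: lF xd.
  by apply: lU Uc _; apply: le_trans cx _; rewrite ler_prime_expV// NJ.
apply: (@le_trans _ _ (mu (X `&` \bigcup_m D m))); last first.
  have mXD : measurable (X `&` \bigcup_m D m).
    by apply: measurableI => //; exact: bigcupT_measurable.
  by apply: le_mu => // x [].
rewrite setI_bigcupr.
rewrite (measure_semi_bigcup mu mD); last 2 first.
- exact: trivIset_seqDU.
- exact: bigcupT_measurable.
rewrite (@measure_semi_bigcup _ _ _ mu (fun m => X `&` D m)); last 3 first.
- by move=> m; exact: measurableI.
- by apply: trivIset_setIl; exact: trivIset_seqDU.
- by apply: bigcupT_measurable => m; exact: measurableI.
by rewrite -nneseriesZl//; exact: lee_nneseries.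
Qed.

Let cassels_level J U : level_set J U ->
  (p%:R^-1)%:E * mu (lim_sup_set G `&` U) <= mu (lim_sup_set F `&` U).
Proof.
move=> lU; have mU := level_set_measurable p_prime lU.
have [N0 N0J] := l_oo J.
rewrite -!lim_sup_setI.
have /cvge_to_ge : mu (\bigcup_(n in [set n | N <= n]%N) (F n `&` U)) @[N --> \oo]
    --> mu (lim_sup_set (fun n => F n `&` U)).
  by apply: tail_cvg => n; [exact: measurableI|move=> x [/FZ]].
apply; near=> N; apply: le_trans (cassels_tail lU _); last first.
  move=> n Nn; apply: N0J; apply: leq_trans Nn.
  by near: N; exact: nbhs_infty_ge.
rewrite lee_wpmul2l ?lee_fin ?invr_ge0//.
by apply: lim_sup_set_ub => n; exact: measurableI.
Unshelve. all: by end_near.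
Qed.

(** The tails of F have complements in Z_p that are decreasing limits of level
    sets, where the previous comparison applies; lim sup F misses them. *)
Lemma cassels : mu (lim_sup_set G) = mu (lim_sup_set F).
Proof.
have mWF := lim_sup_set_measurable mF.
have mWG := lim_sup_set_measurable mG.
have FGlim : lim_sup_set F `<=` lim_sup_set G.
  by move=> x Fx N _; have [n Nn /FG Gx] := Fx N I; exists n.
suff GF0 : mu (lim_sup_set G `\` lim_sup_set F) = 0.
  by rewrite (mu_setDI mWG mWF) GF0 add0e setIidr.
have p0 : (0 < p%:R^-1 :> R)%R by rewrite invr_gt0 prime_gt0r.
have mT N : measurable (\bigcup_(j in [set j | N <= j]%N) F j).
  exact: bigcup_measurable.
have tail0 N :
    mu (lim_sup_set G `\` \bigcup_(j in [set j | N <= j]%N) F j) = 0.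
  pose V K := \bigcup_(j in [set j | N <= j < K]%N) F j.
  have mV K : measurable (V K) by exact: bigcup_measurable.
  have G_le K : (p%:R^-1)%:E *
      mu (lim_sup_set G `\` \bigcup_(j in [set j | N <= j]%N) F j) <=
      mu (lim_sup_set F) - mu (lim_sup_set F `&` V K).
    have [m lV] := block_level N K lF.
    have := cassels_level (level_setC lV); rewrite -!setDE => h.
    rewrite -mu_setD//; last by move=> x /(_ 0%N I)[n _ /FZ].
    apply: le_trans h; rewrite lee_wpmul2l ?lee_fin ?(ltW p0)//.
    apply: le_mu; [exact: measurableD|exact: (measurableD mWG (mV K))|].
    by apply: setDS => x [j /= /andP[Nj _] Fx]; exists j.
  have WFfin : mu (lim_sup_set F) \is a fin_num.
    apply: (haar_Zpadic_fin p_prime mu_haar) => //.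
    by move=> x /(_ 0%N I)[n _ /FZ].
  have : (p%:R^-1)%:E *
      mu (lim_sup_set G `\` \bigcup_(j in [set j | N <= j]%N) F j) <= 0.
    have /cvge_to_ge : mu (lim_sup_set F) - mu (lim_sup_set F `&` V K) @[K --> \oo]
      --> 0; last by apply; near=> K; exact: (G_le K).
    rewrite -[X in _ --> X](subee WFfin); apply: cvgeB.
    - by rewrite fin_num_adde_defr.
    - exact: cvg_cst.
    - rewrite -[X in _ --> mu X](@setIidl _ _ (\bigcup_(j in [set j | N <= j]%N) F j)).
        exact: block_cvg.
      by move=> x /(_ N I).
  by rewrite pmule_rle0 ?lte_fin// measure_le0 => /eqP.
apply/negligibleP; first exact: measurableD.
have -> : lim_sup_set G `\` lim_sup_set F =
    \bigcup_N (lim_sup_set G `\` \bigcup_(j in [set j | N <= j]%N) F j).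
  by rewrite setDE setC_bigcap setI_bigcupr; under eq_bigcupr do rewrite -setDE.
apply: negligible_bigcup => N.
by apply/negligibleP; [exact: measurableD|exact: tail0].
Unshelve. all: by end_near.
Qed.

End Cassels.
End LimSup.

(** * Coprime integers in residue classes *)

Section CoprimeResidue.
Local Open Scope nat_scope.

(** If every prime power exactly dividing n is less than B, then so is every
    prime divisor of n, and n is at most B ^ B. *)
Lemma large_prime_power_divisor B : exists M, forall n, M < n ->
  exists q, [/\ prime q, q %| n & B <= q ^ logn q n].
Proof.
exists (B ^ B) => n Bn; apply: contrapT => noq.
have n0 : 0 < n by apply: leq_trans Bn.
have small q : q \in primes n -> q ^ logn q n < B.
  rewrite mem_primes => /and3P[q_pr _ qn]; rewrite ltnNge; apply/negP => Bq.
  by apply: noq; exists q.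
have primesB : size (primes n) <= B.
  rewrite -(size_iota 0 B); apply: uniq_leq_size; first exact: primes_uniq.
  move=> q qn; rewrite mem_iota add0n; apply: leq_ltn_trans (small q qn).
  by rewrite -[leqLHS]expn1 leq_pexp2l ?logn_gt0//; move: qn;
    rewrite mem_primes => /and3P[/prime_gt0].
have [B0|B0] := posnP B.
  move: primesB; rewrite B0 leqn0 size_eq0 => /eqP primes0.
  move: Bn; rewrite B0 expn0 ltnNge => /negP; apply.
  by rewrite (prod_prime_decomp n0) prime_decompE primes0 big_nil.
move: Bn; rewrite ltnNge => /negP; apply.
rewrite [leqLHS](prod_prime_decomp n0) prime_decompE big_map.
apply: (@leq_trans (\prod_(q <- primes n) B)).
  rewrite big_seq [leqRHS]big_seq; apply: leq_prod => q qn.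
  exact/ltnW/small.
by rewrite big_const_seq count_predT iter_muln_1 leq_pexp2l.
Qed.

(** Write n = d e with d a large prime power and e prime to d. The numbers
    d + e y (or y when e = 1) are prime to n as soon as y is prime to d, and
    among two values of y in the required class modulo Q at least one is. *)
Lemma coprime_in_residue_class Q : 0 < Q -> exists M, forall n, M < n ->
  coprime n Q -> forall c, exists a, [/\ a < n, coprime a n & a = c %[mod Q]].
Proof.
move=> Q0; have [M hM] := large_prime_power_divisor (4 * Q).
exists M => n Mn nQ c; have [q [q_pr qn dQ]] := hM n Mn.
have n0 : 0 < n by apply: leq_trans Mn.
have [d dE] : exists d, d = q ^ logn q n by eexists.
rewrite -dE in dQ.
have [e qe nE] := pfactor_coprime q_pr n0; rewrite -dE in nE.
have l0 : 0 < logn q n by rewrite logn_gt0 mem_primes q_pr n0.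
have e0 : 0 < e by move: n0; rewrite nE muln_gt0 => /andP[].
have de : coprime d e by rewrite dE coprimeXl.
have eQ : coprime e Q by move: nQ; rewrite nE coprimeMl => /andP[].
have qQ : coprime q Q by move: nQ; rewrite nE coprimeMl dE coprime_pexpl// => /andP[].
pose t := if e == 1 then 0 else d.
have [y0 y0Q y0E] : exists2 y, y < Q & t + e * y = c %[mod Q].
  have [u v uv _] := egcdnP Q e0; rewrite (eqP eQ) in uv.
  exists ((u * (c + t * Q.-1)) %% Q); first by rewrite ltn_mod.
  set x := c + t * Q.-1.
  have -> : t + e * (u * x %% Q) = t + e * (u * x) %[mod Q].
    by rewrite -modnDmr modnMmr modnDmr.
  have -> : t + e * (u * x) = (v * x + t) * Q + c.
    rewrite mulnA [e * u]mulnC uv /x -[in LHS](prednK Q0) -[in RHS](prednK Q0) /=.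
    by ring.
  by rewrite modnMDl.
have [y [y2Q qy yE]] : exists y, [/\ y < 2 * Q, coprime q y & t + e * y = c %[mod Q]].
  have [qy0|qy0] := boolP (coprime q y0).
    by exists y0; split=> //; lia.
  exists (y0 + Q); split; first by lia.
    move: qy0; rewrite prime_coprime// negbK => qy0.
    by rewrite prime_coprime// dvdn_addr// -prime_coprime.
  by rewrite mulnDr addnA addnC modnMDl.
exists (t + e * y); split=> //.
  rewrite /t nE; case: (eqVneq e 1) => [->|e1]; first by lia.
  have h1 : e * (2 * y + 2) <= e * d by rewrite leq_mul2l; lia.
  have h2 : 2 * d <= e * d by rewrite leq_mul2r; lia.
  by lia.
rewrite nE coprimeMr; apply/andP; split.
  rewrite /coprime /t; case: (eqVneq e 1) => [->|_]; first by rewrite gcdn1.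
  by rewrite gcdnC addnC mulnC gcdnMDl gcdnC -/(coprime d e).
rewrite dE coprimeXr// coprime_sym.
rewrite /coprime /t; case: (eqVneq e 1) => [->|_]; first by rewrite mul1n.
rewrite dE -(prednK l0) expnSr gcdnMDl -/(coprime q (e * y)).
by rewrite coprimeMr qe qy.
Qed.

End CoprimeResidue.

(** * The zero-one law *)

(** Closeness to a / n, for n prime to p, is written without division: then
    |x - a / n| = |x n - a|. Radii are powers of p, given by their level. *)
Definition approx_at (p K : nat) (P : pred nat) (lev : nat -> nat) (n : nat) :
    set (Qp p) :=
  [set x | [/\ Zpadic p x, P n & exists a : int,
     [/\ (`|a| <= K * n)%N, coprime `|a| n &
         Qp_abs (x * n%:R - a%:~R) <= p%:R ^- lev n]]].
Arguments approx_at : clear implicits.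

Section ZeroOne.
Context (R : realType) (p : nat) (p_prime : prime p).
Context (mu : {measure set (Qp p) -> \bar R}) (mu_haar : is_haar_measure mu).
Context (K : nat) (P : pred nat).
Hypotheses (K_gt0 : (0 < K)%N) (P_coprime : forall n, P n -> coprime p n).
Implicit Types lev : nat -> nat.

Lemma approx_at_level lev n : level_set (lev n) (approx_at p K P lev n).
Proof.
move=> x y [xZ Pn [a [aK an xa]]] yx; split=> //.
  exact: (Zpadic_level p_prime (l := lev n)) xZ yx.
exists a; split=> //.
have -> : y * n%:R - a%:~R = (y - x) * n%:R + (x * n%:R - a%:~R) by ring.
by rewrite Qp_abs_maxl// Qp_absM (Qp_abs_nat1 p_prime (P_coprime Pn)) mulr1.
Qed.

Lemma approx_at_measurable lev n : measurable (approx_at p K P lev n).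
Proof. exact: level_set_measurable (approx_at_level (lev := lev) (n := n)). Qed.

Lemma approx_at_Zpadic lev n : approx_at p K P lev n `<=` Zpadic p.
Proof. by move=> x []. Qed.

Lemma approx_measurable lev : measurable (lim_sup_set (approx_at p K P lev)).
Proof. by apply: lim_sup_set_measurable => n; exact: approx_at_measurable. Qed.

Lemma approx_Zpadic lev : lim_sup_set (approx_at p K P lev) `<=` Zpadic p.
Proof. by move=> x /(_ 0%N I)[n _ []]. Qed.

Section Unbounded.
Context (lev : nat -> nat).
Hypothesis lev_oo : forall J, exists N, forall n, (N <= n)%N -> (J <= lev n)%N.

Let W s := lim_sup_set (approx_at p K P (fun n => lev n - s)%N).

(** A ball of the coarser family has the fraction a / n among its points, and
    around it lies the corresponding ball of the finer family. *)
Let approx_rescale s : mu (W s) = mu (W 0).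
Proof.
elim: s => // s <-; rewrite /W.
apply: (cassels p_prime mu_haar (l := fun n => (lev n - s.+1)%N)).
- by move=> n; exact: approx_at_Zpadic.
- move=> n x [xZ Pn [a [aK an xa]]]; split=> //; exists a; split=> //.
  by apply: le_trans xa _; rewrite ler_prime_expV//; lia.
- by move=> n; exact: approx_at_level.
- move=> n; apply: level_set_le (@approx_at_level _ n) => //; lia.
- move=> n c [cZ Pn [a [aK an ca]]].
  have n1 := Qp_abs_nat1 p_prime (P_coprime Pn).
  have n0 : (n%:R : Qp p) != 0 by rewrite -Qp_abs_eq0 n1 oner_eq0.
  exists (a%:~R / n%:R); last first.
    rewrite /lball/=; apply: le_trans ca; rewrite -[leLHS]mulr1.
    by rewrite -[X in _ * X <= _]n1 -Qp_absM mulrBl divfK// Qp_dist_sym.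
  split=> //.
    by rewrite /Zpadic/= Qp_absM Qp_absV n1 invr1 mulr1; exact: Qp_abs_int_le1.
  exists a; split=> //.
  by rewrite divfK// subrr Qp_abs0 ltW// prime_expV_gt0.
- move=> J; have [N NJ] := lev_oo (J + s.+1)%N.
  by exists N => n /NJ; lia.
Qed.

(** Dividing x - c by p^j turns the approximation a / n into
    ((a - c n) / p^j) / n, whose numerator is again at most K n. *)
Let approx_zoom j c y : (c < p ^ j)%N -> Zpadic p y ->
  W 0 (c%:R + p%:R ^+ j * y) -> W j y.
Proof.
move=> cj yZ W0 N _; have [N0 N0j] := lev_oo j.
have [n /= Nn [xZ Pn [a [aK an xa]]]] := W0 (maxn N N0) I.
move: Nn; rewrite geq_max => /andP[Nn /N0j jn].
rewrite subn0 in xa.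
have px : Qp_abs (p%:R ^+ j : Qp p) = p%:R ^- j by exact: Qp_abs_primeX.
have n1 := Qp_abs_nat1 p_prime (P_coprime Pn).
have pj : (p ^ j %| `|(a - (c * n)%N%:Z)%R|)%N.
  rewrite -(Qp_abs_int_le p_prime).
  have -> : (a - (c * n)%N%:Z)%:~R =
      p%:R ^+ j * (y * n%:R) - ((c%:R + p%:R ^+ j * y) * n%:R - a%:~R) :> Qp p.
    by rewrite intrB -pmulrn natrM; ring.
  apply: Qp_abs_maxB; last by apply: le_trans xa _; rewrite ler_prime_expV.
  by rewrite !Qp_absM px n1 mulr1 ler_piMr// ltW// prime_expV_gt0.
have /dvdzP[b bE] : ((p ^ j)%N%:Z %| a - (c * n)%N%:Z)%Z by [].
have aE : a = b * (p ^ j)%N%:Z + (c * n)%N%:Z by rewrite -bE subrK.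
have pj0 : (0 < p ^ j)%N by rewrite expn_gt0 prime_gt0.
exists n => //; split=> //; exists b; split.
- have : (`|b| * p ^ j <= K * n * p ^ j)%N; last by rewrite leq_pmul2r.
  have -> : (`|b| * p ^ j = `|(a - (c * n)%N%:Z)%R|)%N by rewrite bE abszM.
  have : (`|(a - (c * n)%N%:Z)%R| <= `|a| + c * n)%N by lia.
  move/leq_trans; apply; apply: (@leq_trans (K * n + c * n)).
    by rewrite leq_add2r.
  rewrite -mulnDl mulnAC leq_mul2r; apply/orP; right.
  have := leq_mul K_gt0 (leqnn (p ^ j).-1).
  by nia.
- have /eqP ga : gcdn `|a| n == 1%N by [].
  rewrite /coprime -dvdn1 -[X in (_ %| X)%N]ga dvdn_gcd dvdn_gcdr andbT.
  change ((gcdn `|b| n)%:Z %| a)%Z; rewrite aE; apply: rpredD.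
    by apply: dvdz_mulr; rewrite dvdzE dvdn_gcdl.
  by rewrite dvdzE; apply: dvdn_mull; exact: dvdn_gcdr.
have xaE : (c%:R + p%:R ^+ j * y) * n%:R - a%:~R =
    p%:R ^+ j * (y * n%:R - b%:~R) :> Qp p.
  have -> : a%:~R = b%:~R * p%:R ^+ j + c%:R * n%:R :> Qp p.
    by rewrite aE intrD intrM -!pmulrn natrM natrX.
  by move: (p%:R ^+ j) => q; ring.
move: xa; rewrite xaE Qp_absM px -ler_pdivlMl ?prime_expV_gt0// invrK.
move/le_trans; apply; rewrite -[X in _ * _ ^- X <= _](subnKC jn) exprD invfM.
by rewrite mulrA mulfV ?mul1r// expf_neq0// gt_eqF ?prime_gt0r.
Qed.

Local Open Scope ereal_scope.

(** Magnified to Z_p, the part of W 0 in a ball of level j lies in W j, which has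
    the measure of W 0. *)
Let approx_lball j x : Zpadic p x ->
  mu (W 0 `&` lball j x) <= mu (W 0) * mu (lball j x).
Proof.
move=> xZ; have [c cj cx] := Zpadic_residue p_prime j xZ.
rewrite -(lball_eq (cx : lball j c%:R x)).
have pX i : (Qp_abs (p%:R ^+ i : Qp p) = p%:R ^- i)%R by exact: Qp_abs_primeX.
have p0 : (p%:R ^+ j : Qp p)%R != 0%R.
  by rewrite -Qp_abs_eq0 pX gt_eqF ?prime_expV_gt0.
pose f (y : Qp p) := (c%:R + p%:R ^+ j * y)%R.
have f_dist y z i : (Qp_abs (f y - f z) <= p%:R ^- (j + i))%R =
    (Qp_abs (y - z) <= p%:R ^- (0 + i))%R.
  have -> : (f y - f z = p%:R ^+ j * (y - z))%R.
    by rewrite /f; move: (p%:R ^+ j)%R => q; ring.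
  rewrite Qp_absM pX add0n exprD invfM ler_pM2l//.
  exact: prime_expV_gt0.
have f_Zp y : Zpadic p y -> lball j (c%:R : Qp p) (f y).
  move=> yZ; rewrite /lball/= /f addrAC subrr add0r Qp_absM pX.
  by rewrite ler_piMr// ltW// prime_expV_gt0.
have f_onto z : lball j (c%:R : Qp p) z -> exists2 y, Zpadic p y & f y = z.
  move=> zc; exists ((z - c%:R) / p%:R ^+ j)%R; last first.
    by rewrite /f mulrC divfK// addrC subrK.
  rewrite /Zpadic/= Qp_absM Qp_absV pX invrK.
  by rewrite -ler_pdivlMr ?mul1r// exprn_gt0// prime_gt0r.
have mW j' : measurable (W j') by exact: approx_measurable.
have := haar_similarity p_prime mu_haar (u := 0) (v := j)
  (Zpadic_level p_prime (l := 0)) (@subset_refl _ _)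
  (lball_level (l := j) (c := c%:R)) f_Zp f_onto
  (fun x y i _ _ => f_dist x y i) (mW 0%N).
rewrite expr0 mul1e setIC => H.
have mZf : measurable (f @^-1` W 0%N `&` Zpadic p).
  rewrite setIC; apply: (similarity_measurable p_prime (u := 0) (v := j)
    (Zpadic_level p_prime (l := 0)) (fun x y i _ _ => f_dist x y i)) => //.
  exact: Zpadic_measurable.
rewrite (haar_lball p_prime mu_haar) muleC -(approx_rescale j).
apply: (@le_trans _ _ ((p%:R ^- j)%:E * mu (f @^-1` W 0%N `&` Zpadic p))).
  rewrite H muleA -EFinM mulVf ?mul1e 1?setIC//.
  by rewrite expf_neq0// gt_eqF ?prime_gt0r.
rewrite lee_wpmul2l ?lee_fin ?(ltW (prime_expV_gt0 _ _ _))//.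
by apply: le_mu => // y [fy yZ]; exact: approx_zoom cj yZ fy.
Qed.

(** The bound on balls passes to W itself and gives mu W <= (mu W)^2. *)
Lemma approx_zero_one_unbounded :
  mu (lim_sup_set (approx_at p K P lev)) = 0 \/
  mu (lim_sup_set (approx_at p K P lev)) = 1.
Proof.
have W0E : lim_sup_set (approx_at p K P lev) = W 0.
  by rewrite /W; congr (lim_sup_set (approx_at _ _ _ _)); apply/funext => n;
    rewrite subn0.
rewrite W0E; have mW : measurable (W 0) by exact: approx_measurable.
have WZ : W 0 `<=` Zpadic p by exact: approx_Zpadic.
have W1 := haar_Zpadic_le1 p_prime mu_haar mW WZ.
have Wfin := haar_Zpadic_fin p_prime mu_haar mW WZ.
pose w := fine (mu (W 0)); have wE : mu (W 0) = w%:E by rewrite fineK.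
have w0 : (0 <= w)%R by exact: fine_ge0.
have ww : mu (W 0) <= w%:E * mu (W 0).
  apply: (lim_sup_level_le p_prime mu_haar (l := fun n => (lev n - 0)%N)) => //.
  - by move=> n; exact: approx_at_level.
  - by move=> n; exact: approx_at_Zpadic.
  move=> m V lV VZ; rewrite -wE.
  apply: (level_set_mean_le p_prime _ lV) => // c Vc.
  by apply: approx_lball; exact: VZ.
move: W1 ww; rewrite wE -EFinM !lee_fin => w1 ww.
have [->|wn0] := eqVneq w 0%R; first by left.
right; congr EFin; apply/eqP; rewrite eq_le w1 /=.
have wp : (0 < w)%R by rewrite lt0r wn0.
by rewrite -(ler_pM2l wp) mulr1.
Qed.

End Unbounded.

(** When infinitely many radii are at least p^-J, the numerators prime to n need
    only reach the residue class of x n modulo p^J. *)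
Lemma approx_bounded lev J :
  (forall N, exists n, [/\ (N <= n)%N, P n & (lev n <= J)%N]) ->
  lim_sup_set (approx_at p K P lev) = Zpadic p.
Proof.
move=> levJ; apply/seteqP; split; first exact: approx_Zpadic.
have pJ0 : (0 < p ^ J)%N by rewrite expn_gt0 prime_gt0.
have [M hM] := coprime_in_residue_class pJ0.
move=> x xZ N _; have [n [+ Pn lJ]] := levJ (maxn N M.+1).
rewrite geq_max => /andP[Nn Mn]; exists n => //; split=> //.
have [c _ xc] : exists2 c, (c < p ^ J)%N & Qp_abs (x * n%:R - c%:R) <= p%:R ^- J.
  apply: Zpadic_residue => //; rewrite Qp_absM.
  by rewrite (Qp_abs_nat1 p_prime (P_coprime Pn)) mulr1.
have nJ : coprime n (p ^ J) by rewrite coprime_sym coprimeXl// P_coprime.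
have [a [an a_n ac]] := hM n Mn nJ c.
exists a%:Z; split=> //.
  by rewrite absz_nat (leq_trans (ltnW an))// leq_pmull.
apply: (@le_trans _ _ (p%:R ^- J)); last by rewrite ler_prime_expV.
have -> : x * n%:R - a%:~R = (x * n%:R - c%:R) - (a%:Z - c%:Z)%:~R :> Qp p.
  by rewrite intrB -!pmulrn; ring.
apply: Qp_abs_maxB => //; rewrite Qp_abs_int_le//.
change ((p ^ J)%N%:Z %| a%:Z - c%:Z)%Z.
by rewrite -eqz_mod_dvd !modz_nat ac.
Qed.

Lemma approx_zero_one lev :
  mu (lim_sup_set (approx_at p K P lev)) = 0%E \/
  mu (lim_sup_set (approx_at p K P lev)) = 1%E.
Proof.
have [[J levJ]|lev_oo] := pselect
  (exists J, forall N, exists n, [/\ (N <= n)%N, P n & (lev n <= J)%N]).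
  by right; rewrite (approx_bounded levJ); have [] := mu_haar.
(* The sets are empty at indices outside P; level n there makes the levels
   tend to infinity. *)
pose lev' n := if P n then lev n else n.
have -> : approx_at p K P lev = approx_at p K P lev'.
  apply/funext => n; apply/seteqP; split => x [xZ Pn xa]; split=> //;
    by move: xa; rewrite /lev' Pn.
apply: approx_zero_one_unbounded => J.
apply: contrapT => h; apply: lev_oo; exists J => N.
apply: contrapT => h'; apply: h; exists (maxn N J) => n.
rewrite geq_max => /andP[Nn Jn]; rewrite /lev'; case: ifPn => // Pn.
rewrite leqNgt; apply/negP => lJ; apply: h'; exists n; split=> //.
exact: ltnW.
Qed.

End ZeroOne.

(** * Null sets, spheres and radii *)

Section NullSets.
Context (R : realType) (p : nat) (p_prime : prime p).
Context (mu : {measure set (Qp p) -> \bar R}) (mu_haar : is_haar_measure mu).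
Implicit Types (A B : set (Qp p)).
Local Open Scope ereal_scope.

Definition Qp_rational : set (Qp p) := range (ratr : rat -> Qp p).

Lemma Qp_rational0 : Qp_rational 0%R.
Proof.
exists 0%R => //; have /eqP n0 : numq 0 == 0%R by rewrite numq_eq0.
by rewrite /ratr n0 mul0r.
Qed.

Lemma Qp_ratr_div (a b : int) : (b != 0)%R ->
  ratr (a%:~R / b%:~R) = (a%:~R / b%:~R)%R :> Qp p.
Proof.
move=> b0; have Qp_int0 (c : int) : (c != 0 -> (c%:~R : Qp p) != 0)%R.
  by move=> c0; rewrite -Qp_abs_eq0 Qp_abs_int padic_abs_eq0 intr_eq0.
apply/eqP; rewrite /ratr eqr_div ?Qp_int0 ?denq_neq0// -!intrM; apply/eqP.
congr (_%:~R)%R; apply/eqP; rewrite -(eqr_int rat) !intrM numqE.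
by rewrite mulrAC divfK// intr_eq0.
Qed.

Lemma Qp_rational_div (a b : int) : Qp_rational (a%:~R / b%:~R)%R.
Proof.
have [->|b0] := eqVneq b 0%R.
  by rewrite invr0 mulr0; exact: Qp_rational0.
by exists (a%:~R / b%:~R)%R => //; exact: Qp_ratr_div.
Qed.

Lemma Qp_set1_measurable (x : Qp p) : measurable [set x].
Proof.
have -> : [set x] = \bigcap_l lball l x.
  apply/seteqP; split => y.
    by move=> -> l _; exact: lball_center.
  move=> h; apply/Qp_dist_eq/eqP; rewrite eq_le Qp_abs_ge0 andbT leNgt.
  apply/negP => /(prime_expV_small p_prime)[l]; apply/negP.
  by rewrite -leNgt; exact: h.
by apply: bigcapT_measurable => l; exact: lball_measurable.
Qed.

Lemma haar_set1 (x : Qp p) : mu [set x] = 0.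
Proof.
have le_l l : mu [set x] <= (p%:R ^- l)%:E.
  rewrite -(haar_lball p_prime mu_haar l x); apply: le_mu.
  - exact: Qp_set1_measurable.
  - exact: lball_measurable.
  - by move=> y ->; exact: lball_center.
have fin : mu [set x] \is a fin_num.
  by rewrite ge0_fin_numE// (le_lt_trans (le_l 0%N))// ltry.
apply/eqP; rewrite -(fineK fin) eqe; apply/eqP/le_anti.
rewrite fine_ge0// andbT leNgt; apply/negP => m0.
have [l lm] : exists l : nat, ((fine (mu [set x]))^-1 < l%:R)%R.
  by exists (Num.bound (fine (mu [set x]))^-1); rewrite archi_boundP// invr_ge0 ltW.
have := le_l l; rewrite -(fineK fin) lee_fin leNgt => /negP; apply.
rewrite invf_plt ?posrE ?exprn_gt0 ?prime_gt0r//.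
by apply: lt_trans lm _; rewrite -natrX ltr_nat ltn_expl// prime_gt1.
Qed.

Lemma Qp_rational_negligible : mu.-negligible Qp_rational.
Proof.
have [e eP] := rat_enum.
apply: (@negligibleS _ _ _ _ (\bigcup_k [set (ratr (e k) : Qp p)])).
  by move=> _ [q _ <-]; have [k <-] := eP q; exists k.
apply: negligible_bigcup => k; apply/negligibleP; last exact: haar_set1.
exact: Qp_set1_measurable.
Qed.

(** Balls of radius 0 around fractions only capture rational points, so sets are
    compared outside of these. *)
Lemma haar_le_mod_rational A B : measurable A -> measurable B ->
  (forall x, ~ Qp_rational x -> A x -> B x) -> mu A <= mu B.
Proof.
move=> mA mB AB; have [N [mN N0 QN]] := Qp_rational_negligible.
have mAN : measurable (A `&` N) by exact: measurableI.
rewrite (mu_setDI mu mA mN).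
rewrite [X in _ + X](_ : _ = 0) ?adde0; last first.
  by apply: (subset_measure0 mAN mN _ N0) => x [].
apply: le_mu => //; first exact: measurableD.
by move=> x [Ax nx]; apply: AB => // /QN.
Qed.

Lemma haar_eq_mod_rational A B : measurable A -> measurable B ->
  (forall x, ~ Qp_rational x -> A x <-> B x) -> mu A = mu B.
Proof.
move=> mA mB AB; apply/le_anti/andP.
by split; apply: haar_le_mod_rational => // x /AB[].
Qed.

Lemma haar_sphere k : mu (sphere p k) = ((p%:R - 1) * p%:R ^- k.+1)%:E.
Proof.
have -> : sphere p k = lball k 0%R `\` lball k.+1 0%R.
  apply/seteqP; split => x; rewrite /sphere /lball/= subr0.
    by move=> ->; split=> //; apply/negP; rewrite -ltNge ltr_prime_expV.
  move=> [xk /negP]; rewrite -ltNge => xk1; apply/le_anti; rewrite xk/=.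
  by rewrite leNgt Qp_abs_ltS// -ltNge.
rewrite (mu_setD p_prime mu_haar); last 3 first.
- exact: lball_measurable.
- exact: lball_measurable.
- by rewrite Zpadic_lball; exact: lballS.
rewrite setIidr; last by apply: lballS.
rewrite !(haar_lball p_prime mu_haar) -EFinB; congr EFin.
rewrite mulrBl mul1r exprS invfM mulrA mulfV ?mul1r//.
by rewrite gt_eqF// prime_gt0r.
Qed.

(** Z_p minus the origin is the disjoint union of the spheres. *)
Lemma sphere_sum A (d : nat -> bool) (x : R) : measurable A -> A `<=` Zpadic p ->
  (forall k, mu (A `&` sphere p k) = if d k then mu (sphere p k) else 0) ->
  mu A = x%:E <->
  (fun N => \sum_(0 <= k < N) (d k)%:R * (p%:R - 1) * p%:R ^- k.+1 : R)%R @ \oo --> x.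
Proof.
move=> mA AZ Ad; set s := (fun N => _)%R.
have mAS k : measurable (A `&` sphere p k).
  by apply: measurableI => //; exact: sphere_measurable.
have tS : trivIset setT (fun k => A `&` sphere p k).
  by move=> i j _ _ [y [[_ yi] [_ yj]]]; exact: (sphere_inj p_prime yi yj).
have AE : mu A = mu (\bigcup_k (A `&` sphere p k)).
  apply: haar_eq_mod_rational => //; first exact: bigcupT_measurable.
  move=> y yQ; split=> [Ay|[k _ []//]].
  have y0 : y != 0%R by apply/eqP => y0; apply: yQ; rewrite y0; exact: Qp_rational0.
  by have [k yk] := Qp_abs_level p_prime y0 (AZ y Ay); exists k.
have sE N : \sum_(0 <= k < N) mu (A `&` sphere p k) = (s N)%:E.
  rewrite /s -sumEFin; apply: eq_bigr => k _; rewrite Ad haar_sphere.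
  by case: (d k); rewrite ?mul1r ?mul0r.
have cvgA : (s N)%:E @[N --> \oo] --> mu A.
  rewrite AE; under eq_fun do rewrite -sE.
  by apply: measure_semi_sigma_additive => //; exact: bigcupT_measurable.
have Afin := haar_Zpadic_fin p_prime mu_haar mA AZ.
have scvg : s @ \oo --> fine (mu A).
  by apply: (fine_cvg (f := fun N => (s N)%:E)); rewrite fineK.
split=> [Ax|sx]; first by rewrite Ax in scvg.
by rewrite -(cvg_unique _ scvg sx) ?fineK//; exact: norm_hausdorff.
Qed.

End NullSets.

Section Radius.
Context (R : realType) (p : nat) (p_prime : prime p).
Implicit Types (x y : Qp p) (r : R).

Lemma ratr_prime_expV k : ratr (p%:R ^- k) = p%:R ^- k :> R.
Proof. by rewrite fmorphV rmorphXn/= ratr_nat. Qed.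

(** Only the powers of p matter in a bound on a p-adic absolute value. *)
Lemma radius_level r : 0 < r -> exists l, forall x, Qp_abs x <= 1 ->
  (ratr (Qp_abs x) <= r) = (Qp_abs x <= p%:R ^- l).
Proof.
move=> r0; have exl : exists l, p%:R ^- l <= r.
  exists (Num.bound r^-1); rewrite invf_ple ?posrE ?exprn_gt0 ?prime_gt0r//.
  apply: le_trans (ltW (archi_boundP _)) _; first by rewrite invr_ge0 ltW.
  by rewrite -natrX ler_nat ltnW// ltn_expl// prime_gt1.
case: (ex_minnP exl) => l lr lmin; exists l => x x1.
have [->|x0] := eqVneq x 0; first by rewrite Qp_abs0 raddf0 !ltW ?prime_expV_gt0.
have [k ->] := Qp_abs_level p_prime x0 x1.
rewrite ratr_prime_expV ler_prime_expV//; apply/idP/idP; first exact: lmin.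
by move=> lk; apply: le_trans lr; rewrite ler_prime_expV.
Qed.

Lemma Qp_ball_measurable x r : measurable (Qp_ball x r).
Proof.
rewrite -[Qp_ball x r]setCK; apply: measurableC; apply: open_measurable_Qp.
rewrite openE => y yb; have ry : r < ratr (Qp_abs (y - x)).
  by rewrite ltNge; apply/negP => yr; apply: yb.
apply/nbhs_ballP.
have [r0|r0] := ltP r 0.
  exists 1; first exact: ltr01.
  move=> z _ zb; have : ratr (Qp_abs (z - x)) < 0 :> R by exact: le_lt_trans zb r0.
  by rewrite ltrq0 ltNge Qp_abs_ge0.
exists (Qp_abs (y - x)); first by rewrite /= -(ltr0q R); exact: le_lt_trans ry.
move=> z; rewrite /ball/= => yz zb.
have zx : Qp_abs (z - x) = Qp_abs (y - x).
  by apply: Qp_abs_dominant; have -> : y - x - (z - x) = y - z by ring.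
have : ratr (Qp_abs (z - x)) <= r by exact: zb.
by rewrite zx leNgt ry.
Qed.

Lemma Cset_at_measurable psi n : measurable (@Cset_at R p psi n).
Proof.
rewrite /Cset_at bigcup_mkcond; apply: countable_bigcupT_measurable => [|a].
  exact: countableP.
case: ifP => _; last exact: measurable0.
apply: measurableI; last exact: Zpadic_measurable.
exact: Qp_ball_measurable.
Qed.

Lemma Cset_measurable psi : measurable (@Cset R p psi).
Proof. by apply: lim_sup_set_measurable => n; exact: Cset_at_measurable. Qed.

Lemma Cset_Zpadic psi : @Cset R p psi `<=` Zpadic p.
Proof. by move=> x /(_ 0%N I)[n _ [a _ []]]. Qed.

End Radius.

(** * Inversion *)

Lemma inversion_subE (F : fieldType) (q m x a : F) : x != 0 -> a != 0 ->
  x - q * m / a = - (x / a) * (q / x * m - a).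
Proof. by move=> x0 a0; field; rewrite x0 a0. Qed.

Lemma inversion_diffE (F : fieldType) (q x y : F) : x != 0 -> y != 0 ->
  q / x - q / y = q * (x * y)^-1 * (y - x).
Proof. by move=> x0 y0; field; rewrite x0 y0. Qed.

Section Inversion.
Context (p : nat) (p_prime : prime p).
Implicit Types (x y : Qp p).

Lemma Qp_abs_int_eq1 (a : int) : (Qp_abs (a%:~R : Qp p) == 1) = coprime p `|a|.
Proof.
apply/idP/idP => [/eqP a1|/(Qp_abs_int1 p_prime) -> //].
rewrite prime_coprime// -[X in (X %| _)%N](expn1 p) -(Qp_abs_int_le p_prime) a1.
by rewrite -ltNge -[ltRHS]invr1 -(expr0 p%:R) ltr_prime_expV.
Qed.

Lemma Qp_abs_neq0 x r : Qp_abs x = r -> r != 0 -> x != 0.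
Proof. by move=> <-; rewrite Qp_abs_eq0. Qed.

(** Inversion carries the approximations n / a of a point of a sphere to the
    approximations a / m of a unit. *)
Lemma inversion_dist k m x (a : int) : sphere p k x ->
  Qp_abs (a%:~R : Qp p) = 1 ->
  Qp_abs (x - (p ^ k * m)%N%:R / a%:~R) =
  p%:R ^- k * Qp_abs (p%:R ^+ k / x * m%:R - a%:~R).
Proof.
move=> xk a1; have x0 := sphere_neq0 p_prime xk.
have a0 : a%:~R != 0 :> Qp p by apply: Qp_abs_neq0 a1 _; exact: oner_neq0.
rewrite /sphere/= in xk.
rewrite natrM natrX inversion_subE//.
by rewrite Qp_absM Qp_absN Qp_absM Qp_absV a1 xk invr1 mulr1.
Qed.

Definition Qp_inversion k x : Qp p := p%:R ^+ k / x.

Lemma inversion_sphere k l x : sphere p k x ->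
  Qp_abs (p%:R ^+ l / x) = p%:R ^- l / p%:R ^- k.
Proof. by rewrite /sphere/= => xk; rewrite Qp_absM Qp_absV xk Qp_abs_primeX. Qed.

Section InversionMeasure.
Context (R : realType) (mu : {measure set (Qp p) -> \bar R}).
Context (mu_haar : is_haar_measure mu) (k : nat).

Local Notation f := (Qp_inversion k).

Let f_sphere x : sphere p k x -> sphere p 0 (f x).
Proof.
move=> xk; rewrite /sphere/= /Qp_inversion (inversion_sphere _ xk) expr0 invr1 divff//.
by rewrite gt_eqF// prime_expV_gt0.
Qed.

Let f_onto y : sphere p 0 y -> exists2 x, sphere p k x & f x = y.
Proof.
move=> y1; have y0 := sphere_neq0 p_prime y1; exists (f y).
  by rewrite /sphere/= /Qp_inversion (inversion_sphere _ y1) expr0 invr1 divr1.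
have pk0 : p%:R ^+ k != 0 :> Qp p.
  by rewrite -Qp_abs_eq0 Qp_abs_primeX// gt_eqF// prime_expV_gt0.
by rewrite /Qp_inversion invfM invrK mulrA mulfV// mul1r.
Qed.

Let f_dist x y i : sphere p k x -> sphere p k y ->
  (Qp_abs (f x - f y) <= p%:R ^- (1 + i)) = (Qp_abs (x - y) <= p%:R ^- (k.+1 + i)).
Proof.
move=> xk yk; have x0 := sphere_neq0 p_prime xk; have y0 := sphere_neq0 p_prime yk.
rewrite /Qp_inversion inversion_diffE// !Qp_absM Qp_absV Qp_absM Qp_dist_sym.
rewrite xk yk Qp_abs_primeX//.
have -> : p%:R ^- (k.+1 + i) = p%:R ^- k * p%:R ^- (1 + i) :> rat.
  by rewrite -invfM -exprD addSnnS.
rewrite invfM mulrA mulfV ?gt_eqF ?prime_expV_gt0// mul1r mulrC.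
by rewrite ler_pdivrMr ?prime_expV_gt0// mulrC.
Qed.

Lemma inversion_measurable (S : set (Qp p)) : measurable S ->
  measurable (sphere p k `&` f @^-1` S).
Proof.
apply: (similarity_measurable p_prime (sphere_level p_prime (k := k)) f_dist).
exact: sphere_measurable.
Qed.

Lemma haar_inversion (S : set (Qp p)) : measurable S ->
  ((p%:R ^+ k.+1)%:E * mu (sphere p k `&` f @^-1` S) =
   (p%:R ^+ 1)%:E * mu (sphere p 0 `&` S))%E.
Proof.
exact: (haar_similarity p_prime mu_haar (sphere_level p_prime (k := k))
  (@sphere_Zpadic p p_prime k) (sphere_level p_prime (k := 0)) f_sphere f_onto f_dist).
Qed.

Lemma haar_inversion_null (S : set (Qp p)) : measurable S ->
  mu (sphere p 0 `&` S) = 0%E -> mu (sphere p k `&` f @^-1` S) = 0%E.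
Proof.
move=> mS S0; have /eqP := haar_inversion mS; rewrite S0 mule0 mule_eq0.
by rewrite eqe gt_eqF ?exprn_gt0 ?prime_gt0r//= => /eqP.
Qed.

Lemma haar_inversion_full (S : set (Qp p)) : measurable S ->
  mu (sphere p 0 `&` S) = mu (sphere p 0) ->
  mu (sphere p k `&` f @^-1` S) = mu (sphere p k).
Proof.
move=> mS S1; have := haar_inversion measurableT.
rewrite preimage_setT !setIT -S1 -haar_inversion// => /eqP.
have p0 : (0 < p%:R ^+ k.+1 :> R) by rewrite exprn_gt0 ?prime_gt0r.
have pe : (0 < (p%:R ^+ k.+1)%:E :> \bar R)%E by rewrite lte_fin.
have pfin : (p%:R ^+ k.+1)%:E \is a @fin_num R by [].
by move=> /eqP e; apply/le_anti/andP; split; rewrite -(lee_pmul2l pfin pe) e.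
Qed.
End InversionMeasure.
End Inversion.

(** * Numerator approximations on a sphere *)

Section Spheres.
Context (R : realType) (p : nat) (p_prime : prime p).
Implicit Types (x y : Qp p) (r : R) (psi : nat -> R).

Lemma Qp_abs_nat_level (n k : nat) : Qp_abs (n%:R : Qp p) = p%:R ^- k ->
  exists2 m, n = (p ^ k * m)%N & coprime p m.
Proof.
move=> nk; have : (p ^ k %| `|n%:Z|)%N by rewrite -(Qp_abs_int_le p_prime) nk.
move=> /dvdnP[m /= nE]; exists m; first by rewrite mulnC.
change (coprime p `|m%:Z|); rewrite -(Qp_abs_int_eq1 p_prime); apply/eqP.
move: nk; rewrite nE natrM natrX Qp_absM Qp_abs_primeX// => /eqP.
have pk0 : p%:R ^- k != 0 :> rat by rewrite gt_eqF ?prime_expV_gt0.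
by rewrite -[eqbRHS]mul1r (inj_eq (mulIf pk0)) => /eqP.
Qed.

Lemma irrational_radius_gt0 x (a b : int) r : ~ Qp_rational x ->
  ratr (Qp_abs (x - a%:~R / b%:~R)) <= r -> 0 < r.
Proof.
move=> xQ xr; apply: lt_le_trans xr; rewrite ltr0q; apply: Qp_abs_gt0.
by apply/eqP => /subr0_eq xab; apply: xQ; rewrite xab; exact: Qp_rational_div.
Qed.

Lemma sphere_near k x y r : sphere p k x -> r < p%:R ^- k ->
  ratr (Qp_abs (x - y)) <= r -> sphere p k y.
Proof.
move=> xk rk xy; rewrite /sphere/= -xk; apply: Qp_abs_dominant.
rewrite xk -(ltr_rat R) ratr_prime_expV.
exact: le_lt_trans rk.
Qed.

(** If p divides a, then n / a lies outside Z_p, so a ball around it that reaches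
    Z_p has radius more than 1; the ball of that radius around n / 1 contains
    Z_p. *)
Lemma Cset_at_coprime psi n x (a : int) : (1 < n)%N -> Zpadic p x ->
  (`|a| < n)%N -> coprime `|a| n -> Qp_ball (n%:R / a%:~R) (psi n / n%:R) x ->
  Cset_at p psi n x.
Proof.
move=> n1 xZ an a_n xa; have [pa|pa] := boolP (coprime p `|a|).
  by exists a; [rewrite /= an coprimeMr a_n coprime_sym pa|split].
exists 1; first by rewrite /= n1 coprime1n.
split=> //; apply: le_trans (xa); rewrite ler_rat divr1.
move: pa; rewrite prime_coprime// negbK => pa.
have n_unit : Qp_abs (n%:R : Qp p) = 1.
  apply: Qp_abs_nat1 => //; rewrite prime_coprime//; apply/negP => pn.
  have : (p %| gcdn `|a| n)%N by rewrite dvdn_gcd pa.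
  by rewrite (eqP a_n) dvdn1 => /eqP p1; move: (p_prime); rewrite p1.
have a1 : Qp_abs (a%:~R : Qp p) < 1.
  have := Qp_abs_ltS p_prime (a%:~R : Qp p) 0; rewrite expr0 invr1 => ->.
  by rewrite Qp_abs_int_le// expn1.
have [a0|a0] := eqVneq a 0.
  by move: a_n; rewrite a0 /coprime gcd0n => /eqP n1'; rewrite n1' in n1.
have na : 1 < Qp_abs (n%:R / a%:~R : Qp p).
  rewrite Qp_absM Qp_absV n_unit mul1r invf_gt1// Qp_abs_gt0//.
  by rewrite -Qp_abs_eq0 Qp_abs_int padic_abs_eq0 intr_eq0.
apply: (@le_trans _ _ 1); first by apply: Qp_abs_maxB; rewrite ?n_unit.
rewrite -[n%:R / _](subKr x) in na; rewrite leNgt; apply/negP => x1.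
move: na; rewrite ltNge => /negP; apply.
by apply: Qp_abs_maxB => //; exact: ltW.
Qed.

Lemma Cset_at_full psi n : (1 < n)%N -> 1 <= psi n / n%:R ->
  Cset_at p psi n = Zpadic p.
Proof.
move=> n1 r1; apply/seteqP; split => x; first by move=> [a _ []].
move=> xZ; apply: (Cset_at_coprime (a := 1)) => //; first exact: coprime1n.
rewrite /Qp_ball/= divr1; apply: le_trans r1; have -> : 1 = ratr 1 :> R by rewrite rmorph1.
rewrite ler_rat.
by apply: Qp_abs_maxB => //; exact: Zpadic_nat.
Qed.

Context (mu : {measure set (Qp p) -> \bar R}) (mu_haar : is_haar_measure mu).

Section Dichotomy.
Context (psi : nat -> R) (k : nat).
Let rad n : R := psi n / n%:R.

(** The balls around p^k m / a, for a prime to p, are then not points and stay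
    inside the k-th sphere, on which their centres lie. *)
Let active (m : nat) : bool :=
  [&& coprime p m, 0 < rad (p ^ k * m) & rad (p ^ k * m) < p%:R ^- k].

(** A ball that meets the sphere and has radius at least p^-k contains it. *)
Let Cset_sphere_full :
  (forall N, exists n x, [/\ (N <= n)%N, p%:R ^- k <= rad n,
     sphere p k x & Cset_at p psi n x]) ->
  sphere p k `<=` Cset p psi.
Proof.
move=> h y yk N _; have [n [x [Nn kn xk [a an [xa xZ]]]]] := h N.
exists n => //; exists a => //; split; last exact: (sphere_Zpadic p_prime yk).
rewrite /Qp_ball/=; have -> : y - n%:R / a%:~R = (y - x) + (x - n%:R / a%:~R) by ring.
have := Qp_abs_max (y - x) (x - n%:R / a%:~R); rewrite -(ler_rat R) => /le_trans.
apply; rewrite maxEle; case: ifP => _ //.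
apply: le_trans kn; rewrite -ratr_prime_expV ler_rat.
by apply: Qp_abs_maxB; rewrite ?xk ?yk.
Qed.

Let rad_level : exists lev : nat -> nat, forall m, active m ->
  forall y : Qp p, Qp_abs y <= 1 ->
    (ratr (Qp_abs y) <= rad (p ^ k * m) * p%:R ^+ k) = (Qp_abs y <= p%:R ^- lev m).
Proof.
have : forall m, exists l, active m -> forall y : Qp p, Qp_abs y <= 1 ->
    (ratr (Qp_abs y) <= rad (p ^ k * m) * p%:R ^+ k) = (Qp_abs y <= p%:R ^- l).
  move=> m; have [/and3P[_ r0 _]|_] := boolP (active m); last by exists 0%N.
  have [l hl] := radius_level p_prime (mulr_gt0 r0 (exprn_gt0 k (prime_gt0r p_prime R))).
  by exists l => _.
by move=> /choice[lev levE]; exists lev => m am; exact: levE.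
Qed.

(** A ball of radius less than p^-k that meets the k-th sphere has its centre on
    it, which forces n = p^k m with m prime to p; inversion does the rest. *)
Let Cset_sphere_approx (lev : nat -> nat) :
  (forall m, active m -> forall y : Qp p, Qp_abs y <= 1 ->
    (ratr (Qp_abs y) <= rad (p ^ k * m) * p%:R ^+ k) = (Qp_abs y <= p%:R ^- lev m)) ->
  (exists N, forall n x, (N <= n)%N -> sphere p k x -> Cset_at p psi n x ->
     rad n < p%:R ^- k) ->
  forall x, ~ Qp_rational x ->
  (Cset p psi `&` sphere p k) x <->
  (sphere p k `&` Qp_inversion k @^-1`
    lim_sup_set (approx_at p (p ^ k) active lev)) x.
Proof.
move=> levE [N0 small] x xQ.
have pk0 : (0 < p ^ k)%N by rewrite expn_gt0 prime_gt0.
have fZ : sphere p k x -> Zpadic p (p%:R ^+ k / x).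
  move=> xk; rewrite /Zpadic/= (inversion_sphere p_prime _ xk) divff//.
  by rewrite gt_eqF// prime_expV_gt0.
have distE m (a : int) : sphere p k x -> coprime p `|a| ->
    (ratr (Qp_abs (x - (p ^ k * m)%N%:R / a%:~R)) <= rad (p ^ k * m)) =
    (ratr (Qp_abs (p%:R ^+ k / x * m%:R - a%:~R)) <= rad (p ^ k * m) * p%:R ^+ k).
  move=> xk pa; rewrite (inversion_dist p_prime m xk) ?Qp_abs_int1//.
  by rewrite rmorphM/= ratr_prime_expV mulrC ler_pdivrMr// exprn_gt0 ?prime_gt0r.
have le1 m (a : int) : sphere p k x -> Qp_abs (p%:R ^+ k / x * m%:R - a%:~R) <= 1.
  move=> xk; apply: Qp_abs_maxB; last exact: Qp_abs_int_le1.
  rewrite Qp_absM -[leRHS]mulr1; apply: ler_pM; rewrite ?Qp_abs_ge0//; first exact: fZ.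
  exact: Zpadic_nat.
split=> [[Cx xk]|[xk Wx]]; split=> // N _.
- have [n /= Nn Cnx] := Cx (maxn N0 (p ^ k * N)) I.
  move: Nn; rewrite geq_max => /andP[N0n Nn].
  have rn := small n x N0n xk Cnx; have [a /= /andP[an a_pn] [xa xZ]] := Cnx.
  have r0 : 0 < rad n by exact: (@irrational_radius_gt0 x n%:Z a).
  have pa : coprime p `|a|.
    by move: a_pn; rewrite coprimeMr coprime_sym => /andP[].
  have na := sphere_near xk rn xa; move: na.
  rewrite /sphere/= Qp_absM Qp_absV Qp_abs_int1// invr1 mulr1.
  move=> /Qp_abs_nat_level[m nE pm].
  exists m; first by move: Nn; rewrite /= nE leq_pmul2l.
  have act : active m by rewrite /active pm -nE r0 rn.
  split=> //; first exact: fZ.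
  exists a; split; first by rewrite -nE ltnW.
    by move: a_pn; rewrite nE !coprimeMr => /and3P[].
  by rewrite -levE//; [rewrite -distE// -nE|exact: le1].
- have [m /= Nm [_ act [a [am a_m xa]]]] := Wx (maxn N 2) I.
  move: Nm; rewrite geq_max => /andP[Nm m2].
  move: xa; rewrite -levE//; last exact: le1.
  move=> xa; have /and3P[pm r0 rk] := act.
  have r1 : rad (p ^ k * m) * p%:R ^+ k < 1.
    by rewrite -ltr_pdivlMr ?exprn_gt0 ?prime_gt0r// mul1r.
  have pa : coprime p `|a|.
    rewrite -(Qp_abs_int_eq1 p_prime); apply/eqP.
    have fm : sphere p 0 (p%:R ^+ k / x * m%:R).
      rewrite /sphere/= Qp_absM (inversion_sphere p_prime _ xk).
      rewrite divff ?gt_eqF ?prime_expV_gt0// mul1r expr0 invr1.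
      exact: Qp_abs_nat1.
    have := sphere_near fm _ xa; rewrite /sphere/= expr0 invr1.
    by rewrite expr0 invr1 in r1 *; apply.
  (* |a| = p^k m is excluded: a is prime to m, and m > 1 *)
  exists (p ^ k * m)%N; first by rewrite /= (leq_trans Nm)// leq_pmull.
  exists a => /=; last first.
    split; last exact: (sphere_Zpadic p_prime xk).
    by rewrite /Qp_ball/= -/(rad _) distE.
  have apn : coprime `|a| (p * (p ^ k * m)).
    by rewrite !coprimeMr coprimeXr ?a_m ?(coprime_sym _ p) ?pa.
  rewrite apn andbT ltn_neqAle am andbT; apply: contraTneq a_m => ->.
  by rewrite /coprime gcdnC gcdnMl; apply/eqP; lia.
Qed.

(** Sphere by sphere, inversion turns the set into a set of approximations of
    units, to which the zero-one law applies. *)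
Lemma Cset_sphere_zero_full :
  mu (Cset p psi `&` sphere p k) = 0%E \/
  mu (Cset p psi `&` sphere p k) = mu (sphere p k).
Proof.
have [h|h] := pselect (forall N, exists n x, [/\ (N <= n)%N, p%:R ^- k <= rad n,
    sphere p k x & Cset_at p psi n x]).
  by right; rewrite setIidr//; exact: Cset_sphere_full.
have [lev levE] := rad_level.
have small : exists N, forall n x, (N <= n)%N -> sphere p k x ->
    Cset_at p psi n x -> rad n < p%:R ^- k.
  apply: contrapT => h'; apply: h => N; apply: contrapT => h''; apply: h'.
  exists N => n x Nn xk Cx; rewrite ltNge; apply/negP => kn; apply: h''.
  by exists n, x.
have act_p m : active m -> coprime p m by move=> /and3P[].
set W := lim_sup_set (approx_at p (p ^ k) active lev).
have mW : measurable W by exact: approx_measurable.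
have -> : mu (Cset p psi `&` sphere p k) =
    mu (sphere p k `&` Qp_inversion k @^-1` W).
  apply: (haar_eq_mod_rational p_prime mu_haar).
  - by apply: measurableI; [exact: Cset_measurable|exact: sphere_measurable].
  - exact: inversion_measurable.
  - exact: Cset_sphere_approx.
have mS0 := sphere_measurable p_prime 0.
have pk0 : (0 < p ^ k)%N by rewrite expn_gt0 prime_gt0.
have [W0|W1] := approx_zero_one p_prime mu_haar pk0 act_p lev.
  left; apply: (haar_inversion_null p_prime mu_haar) => //.
  by apply: (subset_measure0 _ mW _ W0); [exact: measurableI|move=> x []].
right; apply: (haar_inversion_full p_prime mu_haar) => //.
have ZW : mu (Zpadic p `\` W) = 0%E.
  rewrite (mu_setD p_prime mu_haar (Zpadic_measurable p_prime))//.
  rewrite setIidr; last exact: approx_Zpadic.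
  by rewrite [X in (_ - X)%E]W1; have [_ ->] := mu_haar; rewrite subee.
rewrite [RHS](mu_setDI mu mS0 mW).
have -> : mu (sphere p 0 `\` W) = 0%E; last by rewrite add0e.
apply: (subset_measure0 _ _ _ ZW); first exact: measurableD.
  by apply: measurableD => //; exact: Zpadic_measurable.
by apply: setSD; exact: sphere_Zpadic.
Qed.

End Dichotomy.
End Spheres.

(** * Splitting by height *)

Section Height.

Lemma rat_height_div (a b : int) : b != 0 -> coprime `|a| `|b| ->
  rat_height (a%:~R / b%:~R) = maxn `|a| `|b|.
Proof.
move=> b0 ab; rewrite /rat_height coprimeq_num// coprimeq_den// (negPf b0).
by rewrite abszM absz_sg b0 mul1n -abszE absz_nat.
Qed.

Lemma finite_rat_height N : finite_set [set r : rat | (rat_height r < N)%N].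
Proof.
pose f (u : nat * nat) (b : bool) : rat := (-1) ^+ b * u.1%:R / u.2%:R.
apply: (@sub_finite_set _ _ ((fun v => f v.1 v.2) @` ((`I_N `*` `I_N) `*` [set: bool]))).
  move=> r /=; rewrite gtn_max => /andP[rn rd].
  exists ((`|numq r|%N, `|denq r|%N), numq r < 0) => //.
  rewrite /f /= -[in RHS](divq_num_den r); congr (_ / _).
    by rewrite [in RHS](intEsign (numq r)) rmorphMsign.
  by rewrite -[in RHS](@gez0_abs (denq r))// denq_ge0.
apply: finite_image; apply: finite_setX; last exact: finite_finset.
by apply: finite_setX; exact: finite_II.
Qed.

Lemma infinite_rat_height (S : set rat) :
  infinite_set S <-> forall N, exists2 r, S r & (N <= rat_height r)%N.
Proof.
split=> [infS N|h].
  apply: contrapT => hN; apply: infS; apply: sub_finite_set (finite_rat_height N).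
  by move=> r Sr /=; rewrite ltnNge; apply/negP => Nr; apply: hN; exists r.
move=> /finite_seqP[s sE]; have [r Sr] := h (\max_(r <- s) rat_height r).+1.
rewrite ltnNge => /negP; apply; apply: leq_bigmax_seq => //.
by move: Sr; rewrite sE.
Qed.

End Height.

Section Approximations.
Context (R : realType) (p : nat) (p_prime : prime p).
Implicit Types (x y : Qp p) (psi : nat -> R).

(** The part of the approximations in which the height is the denominator;
    Cset_at collects those in which it is the numerator. *)
Definition Aset_at psi n : set (Qp p) :=
  [set x | Zpadic p x /\ exists a : int,
     [/\ (`|a| <= n)%N, coprime `|a| n &
         Qp_ball (a%:~R / n%:R) (psi n / n%:R) x]].

(** From height 2 on, numerator and denominator differ in absolute value, and
    the height is the larger of the two. *)
Lemma Bset_split psi : Bset p psi = lim_sup_set (Aset_at psi) `|` Cset p psi.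
Proof.
apply/seteqP; split => x.
- move=> [xZ /infinite_rat_height hx].
  have AC N : exists2 n, (N <= n)%N & Aset_at psi n x \/ Cset_at p psi n x.
    have [r /= xr] := hx (maxn N 2); rewrite geq_max => /andP[Nr r2].
    exists (rat_height r) => //; rewrite /rat_height in xr r2 *.
    have denE : (denq r)%:~R = `|denq r|%N%:R :> Qp p.
      by rewrite -[in LHS](@gez0_abs (denq r))// denq_ge0.
    have [le_nd|lt_dn] := leqP `|numq r| `|denq r|.
      rewrite (maxn_idPr le_nd) in xr r2 *; left; split=> //.
      exists (numq r); split=> //; first exact: coprime_num_den.
      by rewrite /Qp_ball/= -denE.
    have {}lt_dn := lt_dn; rewrite (maxn_idPl (ltnW lt_dn)) in xr r2 *; right.
    have n0 : numq r != 0 by apply: contraTneq r2 => ->.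
    have sg0 : (Num.sg (numq r))%:~R != 0 :> Qp p.
      by rewrite -Qp_abs_eq0 Qp_abs_int padic_abs_eq0 intr_eq0 sgr_eq0.
    apply: (@Cset_at_coprime R p p_prime psi _ x (Num.sg (numq r) * denq r)) => //.
    - by rewrite abszM absz_sg n0 mul1n.
    - by rewrite coprime_sym abszM absz_sg n0 mul1n; exact: coprime_num_den.
    - rewrite /Qp_ball/=; apply: le_trans xr; rewrite le_eqVlt; apply/orP; left.
      apply/eqP; congr (ratr (Qp_abs (x - _))).
      have -> : `|numq r|%N%:R = (Num.sg (numq r) * numq r)%:~R :> Qp p.
        by rewrite -normrEsg -abszE.
      by rewrite !intrM -mulf_div divff// mul1r.
  have [h|/existsNP[N0 hN0]] := pselect (forall N, exists2 n, (N <= n)%N & Aset_at psi n x).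
    by left=> N _; have [n Nn An] := h N; exists n.
  right=> N _; have [n] := AC (maxn N N0); rewrite geq_max => /andP[Nn N0n] [An|Cn].
    by exfalso; apply: hN0; exists n.
  by exists n.
- move=> ABx; have xZ : Zpadic p x.
    by case: ABx => /(_ 0%N I)[n _]; [case|case=> a _ []].
  split=> //; apply/infinite_rat_height => N; case: ABx => /(_ (maxn N 1) I)[n /=].
    rewrite geq_max => /andP[Nn n0] [_ [a [an a_n xa]]].
    have n0' : n%:Z != 0 by rewrite -lt0n.
    have rE : rat_height (a%:~R / n%:Z%:~R) = n.
      by rewrite rat_height_div//= (maxn_idPr an).
    by exists (a%:~R / n%:Z%:~R); [rewrite /mkset rE Qp_ratr_div|rewrite rE].
  rewrite geq_max => /andP[Nn n0] [a /= /andP[an a_pn] [xa _]].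
  have a_n : coprime n `|a|.
    by move: a_pn; rewrite coprimeMr coprime_sym => /andP[_]; rewrite coprime_sym.
  have a0 : a != 0.
    apply/eqP => a0; move: a_pn; rewrite a0 /coprime gcd0n => /eqP pn.
    have : (p %| 1)%N by rewrite -pn dvdn_mulr.
    by rewrite dvdn1 => /eqP p1; move: (p_prime); rewrite p1.
  have rE : rat_height (n%:Z%:~R / a%:~R) = n.
    by rewrite rat_height_div//= (maxn_idPl (ltnW an)).
  by exists (n%:Z%:~R / a%:~R); [rewrite /mkset rE Qp_ratr_div|rewrite rE].
Qed.

Lemma Aset_at_measurable psi n : measurable (Aset_at psi n).
Proof.
have -> : Aset_at psi n = \bigcup_(a in [set a : int | (`|a| <= n)%N && coprime `|a| n])
    (Qp_ball (a%:~R / n%:R) (psi n / n%:R) `&` Zpadic p).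
  apply/seteqP; split => x.
    by move=> [xZ [a [an a_n xa]]]; exists a => //=; rewrite an.
  by move=> [a /= /andP[an a_n] [xa xZ]]; split=> //; exists a.
rewrite bigcup_mkcond; apply: countable_bigcupT_measurable => [|a].
  exact: countableP.
case: ifP => _; last exact: measurable0.
apply: measurableI; last exact: Zpadic_measurable.
exact: Qp_ball_measurable.
Qed.

Lemma Aset_measurable psi : measurable (lim_sup_set (Aset_at psi)).
Proof. by apply: lim_sup_set_measurable => n; exact: Aset_at_measurable. Qed.

Lemma Bset_measurable psi : measurable (Bset p psi).
Proof.
rewrite Bset_split; apply: measurableU; first exact: Aset_measurable.
exact: Cset_measurable.
Qed.

(** A reduced fraction whose denominator is divisible by p is at distance more
    than 1 from Z_p. *)
Lemma Aset_at_denominator psi n x : psi n / n%:R < 1 -> Aset_at psi n x ->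
  coprime p n.
Proof.
move=> r1 [xZ [a [an a_n xa]]]; rewrite prime_coprime//; apply/negP => pn.
have pa : coprime p `|a|.
  rewrite prime_coprime//; apply/negP => pa.
  have : (p %| gcdn `|a| n)%N by rewrite dvdn_gcd pa.
  by rewrite (eqP a_n) dvdn1 => /eqP p1; move: (p_prime); rewrite p1.
have n0 : n%:R != 0 :> Qp p.
  have n_gt0 : (0 < n)%N.
    by rewrite lt0n; apply: contraTneq a_n => n0; rewrite n0 in an *;
      rewrite leqn0 in an; rewrite (eqP an).
  by rewrite -Qp_abs_eq0 (Qp_abs_int p n%:Z) padic_abs_eq0 intr_eq0 -lt0n.
have n1 : Qp_abs (n%:R : Qp p) < 1.
  have := Qp_abs_ltS p_prime (n%:R : Qp p) 0; rewrite expr0 invr1 => ->.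
  by rewrite (Qp_abs_int_le p_prime n%:Z) expn1.
have xa1 : Qp_abs (x - a%:~R / n%:R) < 1.
  by rewrite -(ltr_rat R) rmorph1; exact: le_lt_trans r1.
have : Qp_abs (a%:~R / n%:R : Qp p) <= 1.
  by rewrite -[_ / _](subKr x); apply: Qp_abs_maxB => //; exact: ltW.
rewrite Qp_absM Qp_absV Qp_abs_int1// mul1r leNgt invf_gt1 ?n1//.
exact: Qp_abs_gt0.
Qed.

Context (mu : {measure set (Qp p) -> \bar R}) (mu_haar : is_haar_measure mu).
Local Open Scope ereal_scope.

(** Once the radii are less than 1, the denominators that count are prime to p,
    and |x - a / n| = |x n - a|. *)
Lemma Aset_zero_one psi :
  (exists N, forall n, (N <= n)%N -> (psi n / n%:R < 1)%R) ->
  mu (lim_sup_set (Aset_at psi)) = 0 \/ mu (lim_sup_set (Aset_at psi)) = 1.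
Proof.
move=> [N0 small]; pose P n := coprime p n && (0 < psi n / n%:R)%R.
have [lev levE] : exists lev : nat -> nat, forall n, P n ->
    forall x, (Qp_abs x <= 1 -> (ratr (Qp_abs x) <= psi n / n%:R) =
      (Qp_abs x <= p%:R ^- lev n))%R.
  have : forall n, exists l, P n -> forall x, (Qp_abs x <= 1 ->
      (ratr (Qp_abs x) <= psi n / n%:R) = (Qp_abs x <= p%:R ^- l))%R.
    move=> n; have [/andP[_ r0]|_] := boolP (P n); last by exists 0%N.
    by have [l hl] := radius_level p_prime r0; exists l => _.
  by move=> /choice[lev levE]; exists lev => n Pn; exact: levE.
have Pp n : P n -> coprime p n by move=> /andP[].
have distE n x (a : int) : coprime p n ->
    (Qp_abs (x * n%:R - a%:~R) = Qp_abs (x - a%:~R / n%:R))%R.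
  move=> pn; have n1 := Qp_abs_nat1 p_prime pn.
  have n0 : n%:R != 0%R :> Qp p by apply: Qp_abs_neq0 n1 _; exact: oner_neq0.
  by rewrite -[RHS]mulr1 -[X in _ = (_ * X)%R]n1 -Qp_absM mulrBl divfK.
have le1 n x (a : int) : Zpadic p x -> (Qp_abs (x * n%:R - a%:~R) <= 1)%R.
  move=> xZ; apply: Qp_abs_maxB; last exact: Qp_abs_int_le1.
  rewrite Qp_absM -[leRHS]mulr1; apply: ler_pM; rewrite ?Qp_abs_ge0//.
  exact: Zpadic_nat.
suff -> : mu (lim_sup_set (Aset_at psi)) = mu (lim_sup_set (approx_at p 1 P lev)).
  exact: approx_zero_one.
apply: (haar_eq_mod_rational p_prime mu_haar).
- exact: Aset_measurable.
- exact: approx_measurable.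
move=> x xQ; split=> xA N _.
- have [n] := xA (maxn N N0) I; rewrite /= geq_max => /andP[Nn N0n] Anx.
  have pn := Aset_at_denominator (small n N0n) Anx.
  have [xZ [a [an a_n xa]]] := Anx; exists n => //.
  have Pn : P n by rewrite /P pn (@irrational_radius_gt0 R p x a n%:Z _ xQ xa).
  split=> //; exists a; split=> //; first by rewrite mul1n.
  by rewrite -levE//; [rewrite distE|exact: le1].
- have [n Nn [xZ Pn [a [an a_n xa]]]] := xA N I; exists n => //.
  split=> //; exists a; split=> //; first by rewrite mul1n in an.
  by rewrite /Qp_ball/= -distE ?Pp// levE//; exact: le1.
Qed.

End Approximations.

(** * The attained values *)

Section Attained.
Context (R : realType) (p : nat) (p_prime : prime p).
Implicit Types (x : Qp p) (d : nat -> bool).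

(** The radius psi n / n is p^(-k-1) when n has valuation k and d k holds: the
    largest power of p for which a ball centred on the k-th sphere stays on it. *)
Definition layered_psi d (n : nat) : R :=
  if d (logn p n) then n%:R * p%:R ^- (logn p n).+1 else 0.

Lemma layered_psi_ge0 d n : 0 <= layered_psi d n.
Proof.
by rewrite /layered_psi; case: ifP => // _.
Qed.

Lemma layered_radius d n : (0 < n)%N -> layered_psi d n / n%:R =
  if d (logn p n) then p%:R ^- (logn p n).+1 else 0.
Proof.
move=> n0; rewrite /layered_psi; case: ifP => _; last by rewrite mul0r.
by rewrite mulrC mulrA mulVf ?mul1r// pnatr_eq0 -lt0n.
Qed.

Lemma layered_radius_lt1 d n : (0 < n)%N -> layered_psi d n / n%:R < 1.
Proof.
move=> n0; rewrite layered_radius//; case: ifP => // _.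
by rewrite -[ltRHS]invr1 -(expr0 (p%:R : R)) ltr_prime_expV.
Qed.

(** The numerators prime to m reach every residue class modulo p, so the balls
    of radius p^(-k-1) around the p^k m / a cover the k-th sphere. *)
Lemma layered_Cset_full d k : d k -> sphere p k `<=` Cset p (layered_psi d).
Proof.
move=> dk x xk N _; have [M hM] := coprime_in_residue_class (prime_gt0 p_prime).
have x0 := sphere_neq0 p_prime xk.
(* any m prime to p beyond N and M would do *)
pose m := (p * (N + M).+1).+1; pose n := (p ^ k * m)%N.
have pk0 : (0 < p ^ k)%N by rewrite expn_gt0 prime_gt0.
have NMm : (N + M < m)%N.
  by rewrite ltnS (leq_trans (leqnSn _))// leq_pmull// prime_gt0.
have pm : coprime p m by rewrite /m -addn1 /coprime mulnC gcdnMDl gcdn1.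
have mp : coprime m p by rewrite coprime_sym.
have vn : logn p n = k.
  by rewrite /n lognM// pfactorK// logn_coprime// addn0.
have n0 : (0 < n)%N by rewrite muln_gt0 pk0.
have fm1 : Qp_abs (p%:R ^+ k / x * m%:R) = 1.
  rewrite Qp_absM (inversion_sphere p_prime _ xk) divff ?gt_eqF ?prime_expV_gt0//.
  by rewrite mul1r Qp_abs_nat1.
have [c _ fc] : exists2 c, (c < p ^ 1)%N &
    Qp_abs (p%:R ^+ k / x * m%:R - c%:R) <= p%:R ^- 1.
  by apply: Zpadic_residue => //; rewrite fm1.
have Mm : (M < m)%N by apply: leq_ltn_trans NMm; exact: leq_addl.
have [a [am a_m ac]] := hM m Mm mp c.
have fa : Qp_abs (p%:R ^+ k / x * m%:R - a%:Z%:~R) <= p%:R ^- 1.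
  have -> : p%:R ^+ k / x * m%:R - a%:Z%:~R =
      (p%:R ^+ k / x * m%:R - c%:R) - (a%:Z - c%:Z)%:~R :> Qp p.
    by rewrite intrB -!pmulrn; ring.
  apply: Qp_abs_maxB => //; rewrite Qp_abs_int_le// expn1.
  change (p%:Z %| a%:Z - c%:Z)%Z.
  by rewrite -eqz_mod_dvd !modz_nat ac.
have a1 : Qp_abs (a%:Z%:~R : Qp p) = 1.
  rewrite -fm1; apply: Qp_abs_dominant; rewrite fm1.
  by have := Qp_abs_ltS p_prime (p%:R ^+ k / x * m%:R - a%:Z%:~R) 0;
    rewrite expr0 invr1 => ->.
have pa : coprime p a.
  by move/eqP: a1; rewrite (Qp_abs_int_eq1 p_prime).
exists n; first by rewrite /= /n (leq_trans _ (leq_pmull _ _))//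
  (leq_trans (leq_addr M N))// ltnW.
exists a%:Z; last first.
  split; last exact: (sphere_Zpadic p_prime xk).
  rewrite /Qp_ball/= layered_radius// vn dk (inversion_dist p_prime m xk a1).
  rewrite -ratr_prime_expV ler_rat exprSr invfM.
  by rewrite ler_pM2l ?prime_expV_gt0// -[X in _ <= X^-1]expr1.
have ap : coprime a p by rewrite coprime_sym.
rewrite /= !coprimeMr ap coprimeXr// a_m !andbT.
by apply: leq_trans am _; rewrite leq_pmull.
Qed.

(** A ball of positive radius stays on the sphere of its centre n / a, whose
    index is the valuation of n. *)
Lemma layered_Cset_empty d k x : ~~ d k -> ~ Qp_rational x -> sphere p k x ->
  ~ Cset p (layered_psi d) x.
Proof.
move=> dk xQ xk /(_ 1%N I)[n /= n0 [a /= /andP[an a_pn] [xa _]]].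
have r0 := @irrational_radius_gt0 R p x n%:Z a _ xQ xa.
move: xa r0; rewrite /Qp_ball/= layered_radius//; case: ifP => [dn|_]; last first.
  by rewrite ltxx.
move=> xa _.
have pa : coprime p `|a|.
  by move: a_pn; rewrite coprimeMr coprime_sym => /andP[].
have nv : sphere p (logn p n) (n%:R / a%:~R : Qp p).
  have [m pm nE] := pfactor_coprime p_prime n0.
  rewrite /sphere/= Qp_absM Qp_absV Qp_abs_int1// invr1 mulr1.
  rewrite {1}nE natrM natrX Qp_absM Qp_abs_primeX//.
  by rewrite Qp_abs_nat1// mul1r.
have xv : sphere p (logn p n) x.
  apply: (sphere_near (r := p%:R ^- (logn p n).+1 : R) nv).
    by rewrite ltr_prime_expV.
  by rewrite Qp_dist_sym.
by move: dk; rewrite (sphere_inj p_prime xk xv) dn.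
Qed.

Lemma layered_Aset_empty d x : ~~ d 0%N -> ~ Qp_rational x ->
  ~ lim_sup_set (Aset_at (layered_psi d)) x.
Proof.
move=> d0 xQ /(_ 1%N I)[n /= n0 An].
have pn := Aset_at_denominator p_prime (layered_radius_lt1 d n0) An.
have [xZ [a [_ _ xa]]] := An.
have := @irrational_radius_gt0 R p x a n%:Z _ xQ xa.
by rewrite layered_radius// logn_coprime// (negPf d0) ltxx.
Qed.

Context (mu : {measure set (Qp p) -> \bar R}) (mu_haar : is_haar_measure mu).

Lemma layered_Cset d (x : R) :
  (fun N => \sum_(0 <= k < N) (d k)%:R * (p%:R - 1) * p%:R ^- k.+1 : R) @ \oo --> x ->
  mu (Cset p (layered_psi d)) = x%:E.
Proof.
move=> dx; apply/(sphere_sum p_prime mu_haar (d := d)) => //.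
- exact: Cset_measurable.
- exact: Cset_Zpadic.
move=> k; case: ifP => dk; first by rewrite setIidr//; exact: layered_Cset_full.
rewrite -(measure0 mu); apply: (haar_eq_mod_rational p_prime mu_haar) => //.
  by apply: measurableI; [exact: Cset_measurable|exact: sphere_measurable].
move=> y yQ; split=> // -[Cy yk].
exact: (layered_Cset_empty (negbT dk) yQ yk).
Qed.

Lemma layered_Bset d (x : R) : ~~ d 0%N ->
  (fun N => \sum_(0 <= k < N) (d k)%:R * (p%:R - 1) * p%:R ^- k.+1 : R) @ \oo --> x ->
  mu (Bset p (layered_psi d)) = x%:E.
Proof.
move=> d0 dx; rewrite -(layered_Cset dx).
apply: (haar_eq_mod_rational p_prime mu_haar).
- exact: Bset_measurable.
- exact: Cset_measurable.
move=> y yQ; rewrite Bset_split//; split=> [[Ay|//]|Cy]; last by right.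
by exfalso; exact: (layered_Aset_empty d0 yQ).
Qed.

End Attained.

Section Values.
Context (R : realType) (p : nat) (p_prime : prime p).
Context (mu : {measure set (Qp p) -> \bar R}) (mu_haar : is_haar_measure mu).
Implicit Types (psi : nat -> R).

Definition Cset_digit psi k : bool :=
  `[< mu (Cset p psi `&` sphere p k) != 0%E >].

Lemma Cset_value psi (x : R) : mu (Cset p psi) = x%:E ->
  (fun N => \sum_(0 <= k < N) (Cset_digit psi k)%:R * (p%:R - 1) * p%:R ^- k.+1 : R)
    @ \oo --> x.
Proof.
move/(sphere_sum p_prime mu_haar) => H; apply: H.
- exact: Cset_measurable.
- exact: Cset_Zpadic.
move=> k; rewrite /Cset_digit; case: asboolP => [C0|/negP/negPn/eqP//].
by have [C0'|//] := Cset_sphere_zero_full p_prime mu_haar psi k; rewrite C0' eqxx in C0.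
Qed.

Lemma sum_digit0 (d : nat -> bool) : ~~ d 0%N ->
  (fun N => \sum_(0 <= k < N) (d k)%:R * (p%:R - 1) * p%:R ^- k.+1 : R) =
  (fun N => \sum_(1 <= k < N) (d k)%:R * (p%:R - 1) * p%:R ^- k.+1 : R).
Proof.
move=> d0; apply/funext => -[|N]; first by rewrite !big_geq.
by rewrite big_ltn// (negPf d0) !mul0r add0r.
Qed.

Lemma Bset_full psi :
  (forall N, exists2 n, (N <= n)%N & 1 <= psi n / n%:R) ->
  mu (Bset p psi) = 1%E.
Proof.
move=> h; have [_ <-] := mu_haar; congr (mu _); apply/seteqP; split => x.
  by case.
move=> xZ; rewrite Bset_split//; right=> N _; have [n] := h (maxn N 2).
by rewrite geq_max => /andP[Nn n2] r1; exists n => //; rewrite Cset_at_full.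
Qed.

(** On the units inversion exchanges the two kinds of approximations. *)
Lemma Cset_units_null psi :
  (exists N, forall n, (N <= n)%N -> psi n / n%:R < 1) ->
  mu (lim_sup_set (Aset_at psi) : set (Qp p)) = 0%E ->
  mu (Cset p psi `&` sphere p 0) = 0%E.
Proof.
move=> [N0 small] A0.
have mA := @Aset_measurable R p p_prime psi.
have mS0 := sphere_measurable p_prime 0.
have S0A0 : mu (sphere p 0 `&` lim_sup_set (Aset_at psi)) = 0%E.
  by apply: (subset_measure0 _ mA _ A0); [exact: measurableI|move=> x []].
have mfA : measurable (sphere p 0 `&`
    Qp_inversion 0 @^-1` lim_sup_set (Aset_at psi)).
  exact: inversion_measurable.
have fA0 := haar_inversion_null p_prime mu_haar 0 mA S0A0.
apply: (subset_measure0 _ mfA _ fA0).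
  by apply: measurableI => //; exact: Cset_measurable.
move=> x [Cx x1]; split=> // N _.
have [n] := Cx (maxn N N0) I; rewrite /= geq_max => /andP[Nn N0n].
move=> [a /= /andP[an a_pn] [xa xZ]]; exists n => //.
have pa : coprime p `|a|.
  by move: a_pn; rewrite coprimeMr coprime_sym => /andP[].
have a1 := Qp_abs_int1 p_prime pa.
have r1 : psi n / n%:R < p%:R ^- 0 by rewrite expr0 invr1 small.
have : sphere p 0 (n%:R / a%:~R : Qp p) := sphere_near x1 r1 xa.
rewrite /sphere/= Qp_absM Qp_absV a1 invr1 mulr1 ?expr0 ?invr1 => n1.
have n0 : n%:R != 0 :> Qp p by apply: Qp_abs_neq0 n1 _; exact: oner_neq0.
split.
  rewrite /Zpadic/= (inversion_sphere p_prime _ x1).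
  by rewrite ?gt_eqF ?prime_expV_gt0 ?expr0 ?invr1 ?mulr1.
exists a; split; first exact: ltnW.
  by move: a_pn; rewrite coprimeMr => /andP[].
rewrite /Qp_ball/=; have <- : Qp_abs (x - n%:R / a%:~R) =
    Qp_abs (p%:R ^+ 0 / x - a%:~R / n%:R); last exact: xa.
have := inversion_dist p_prime n x1 a1.
rewrite expn0 mul1n => ->; rewrite expr0 invr1 mul1r.
by rewrite -[RHS]mulr1 -[X in _ = _ * X]n1 -Qp_absM mulrBl divfK.
Qed.

(** Either Z_p itself recurs among the balls, or the zero-one law decides on the
    fractions a / n with |a| <= n, and when these contribute nothing the units
    contribute nothing either. *)
Lemma Bset_value psi (x : R) : mu (Bset p psi) = x%:E -> x = 1 \/
  exists2 d : nat -> bool, ~~ d 0%N &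
    (fun N => \sum_(0 <= k < N) (d k)%:R * (p%:R - 1) * p%:R ^- k.+1 : R) @ \oo --> x.
Proof.
move=> Bx; have [h|h] := pselect (forall N, exists2 n, (N <= n)%N & 1 <= psi n / n%:R).
  by left; move: Bx; rewrite Bset_full// => -[].
have small : exists N, forall n, (N <= n)%N -> psi n / n%:R < 1.
  move/existsNP: h => [N hN]; exists N => n Nn; rewrite ltNge; apply/negP => r1.
  by apply: hN; exists n.
have mA := @Aset_measurable R p p_prime psi.
have mC := @Cset_measurable R p p_prime psi.
have mB := @Bset_measurable R p p_prime psi.
have [A0|A1] := Aset_zero_one p_prime mu_haar small; last first.
  left; apply/le_anti/andP; split; rewrite -lee_fin -Bx.
    by apply: (haar_Zpadic_le1 p_prime mu_haar) => // y [].
  rewrite -A1; apply: le_mu => //.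
  by rewrite Bset_split// => y; left.
right; exists (Cset_digit psi).
  by rewrite /Cset_digit (Cset_units_null small A0) eqxx asboolF.
by apply: Cset_value; rewrite -Bx Bset_split// setUC measureU0.
Qed.

End Values.

Theorem theorem2p1 (R : realType) (p : nat)
    (mu : {measure set (Qp p) -> \bar R}) (x : R)
    (p_prime : prime p) (mu_haar : is_haar_measure mu) (x01 : 0 <= x <= 1) :
  ((exists psi : nat -> R,
      (forall n : nat, 0 <= psi n) /\ mu (Cset p psi) = x%:E) <->
   (exists d : nat -> bool,
      (fun N : nat => \sum_(0 <= k < N)
         (d k)%:R * (p%:R - 1) * p%:R ^- k.+1 : R) @ \oo --> x))
  /\
  ((exists psi : nat -> R,
      (forall n : nat, 0 <= psi n) /\ mu (Bset p psi) = x%:E) <->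
   (x = 1 \/
    exists d : nat -> bool,
      (fun N : nat => \sum_(1 <= k < N)
         (d k)%:R * (p%:R - 1) * p%:R ^- k.+1 : R) @ \oo --> x)).
Proof.
split; split.
- move=> [psi [_ /(Cset_value p_prime mu_haar) dx]].
  by exists (Cset_digit mu psi).
- move=> [d dx]; exists (layered_psi R p d).
  by split; [exact: layered_psi_ge0|exact: layered_Cset].
- move=> [psi [_ /(Bset_value p_prime mu_haar)[->|[d d0 dx]]]]; first by left.
  by right; exists d; rewrite -sum_digit0.
- move=> [->|[d dx]].
    exists (fun n => n%:R); split=> //; apply: (Bset_full p_prime mu_haar) => N.
    exists N.+1 => //; rewrite divff// pnatr_eq0.
  pose d' k := (k != 0)%N && d k; exists (layered_psi R p d').
  split; first exact: layered_psi_ge0.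
  apply: layered_Bset => //; rewrite sum_digit0//.
  rewrite (_ : (fun N => _) = (fun N => \sum_(1 <= k < N)
    (d k)%:R * (p%:R - 1) * p%:R ^- k.+1))//.
  apply/funext => N; rewrite big_nat [RHS]big_nat.
  by apply: eq_bigr => -[//|k] _.
Qed.
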